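(* Let $k$ be an algebraically closed field and let $\mathbb{H}\trianglelefteq\mathbb{G}$ be a normal embedding of linearly reductive quantum groups over $k$. Consider the binary relation $\sim$ on $\widehat{\mathbb{G}}\times\widehat{\mathbb{H}}$ defined, for $V\in\widehat{\mathbb{G}}$ and $W\in\widehat{\mathbb{H}}$, by $$V\sim W\iff \mathrm{hom}_{\mathbb{H}}\left(\mathrm{Res}^{\mathbb{G}}_{\mathbb{H}}V,W\right)\ne 0\iff \mathrm{hom}_{\mathbb{G}}\left(V,\mathrm{Ind}^{\mathbb{G}}_{\mathbb{H}}W\right)\ne 0.$$ Then the following hold. (a) The left-hand slices $$\mathrm{slice}_W:=\{V\in\widehat{\mathbb{G}}\mid V\sim W\},\quad W\in\widehat{\mathbb{H}},$$ are the classes of an equivalence relation $\sim_{\mathbb{G}}$ on $\widehat{\mathbb{G}}$, given by: $V\sim_{\mathbb{G}}V'$ if and only if $\mathrm{Res}^{\mathbb{G}}_{\mathbb{H}}V$ and $\mathrm{Res}^{\mathbb{G}}_{\mathbb{H}}V'$ have the same simple constituents. (b) The right-hand slices $${}_V\mathrm{slice}:=\{W\in\widehat{\mathbb{H}}\mid V\sim W\},\quad V\in\widehat{\mathbb{G}},$$ are the classes of an equivalence relation on $\widehat{\mathbb{H}}$, and these classes are finite.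
   Context: All algebras, coalgebras and Hopf algebras are over a fixed algebraically closed field $k$. A (linear algebraic) quantum group $\mathbb{G}$ is a formal object dual to a Hopf algebra $\mathcal{O}(\mathbb{G})$; it is linearly reductive if $\mathcal{O}(\mathbb{G})$ is cosemisimple. An embedding $\mathbb{H}\le\mathbb{G}$ means a surjective Hopf algebra morphism $\pi:\mathcal{O}(\mathbb{G})\to\mathcal{O}(\mathbb{H})$. In Sweedler notation ($\Delta(x)=x_1\otimes x_2$ etc., $S$ the antipode), the embedding is normal, written $\mathbb{H}\trianglelefteq\mathbb{G}$, if both adjoint coactions $\mathrm{ad}_l:x\mapsto x_1S(x_3)\otimes x_2$ and $\mathrm{ad}_r:x\mapsto x_2\otimes S(x_1)x_3$ of $\mathcal{O}(\mathbb{G})$ on itself descend along $\pi$ to $\mathcal{O}(\mathbb{G})$-comodule structures on $\mathcal{O}(\mathbb{H})$; that is, $\mathrm{ad}_l(\ker\pi)\subseteq\mathcal{O}(\mathbb{G})\otimes\ker\pi$ and $\mathrm{ad}_r(\ker\pi)\subseteq\ker\pi\otimes\mathcal{O}(\mathbb{G})$. $\mathrm{Rep}(\mathbb{G})$ is the category of right $\mathcal{O}(\mathbb{G})$-comodules, $\mathrm{hom}_{\mathbb{G}}$ denotes its morphism spaces, and $\widehat{\mathbb{G}}$ is the set of isomorphism classes of simple right $\mathcal{O}(\mathbb{G})$-comodules (which are finite-dimensional). $\mathrm{Res}^{\mathbb{G}}_{\mathbb{H}}:\mathrm{Rep}(\mathbb{G})\to\mathrm{Rep}(\mathbb{H})$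 is corestriction of scalars along $\pi$ (the comodule structure $V\to V\otimes\mathcal{O}(\mathbb{G})$ is composed with $\mathrm{id}\otimes\pi$), and $\mathrm{Ind}^{\mathbb{G}}_{\mathbb{H}}:=-\,\square_{\mathcal{O}(\mathbb{H})}\,\mathcal{O}(\mathbb{G}):\mathrm{Rep}(\mathbb{H})\to\mathrm{Rep}(\mathbb{G})$ is the cotensor product functor, which is right adjoint to $\mathrm{Res}^{\mathbb{G}}_{\mathbb{H}}$; this adjunction gives the second equivalence in the definition of $\sim$. The simple constituents of a comodule over a cosemisimple Hopf algebra are the isomorphism classes of its simple summands. *)

(* Defs.v *)
From HB Require Import structures.
From mathcomp Require Import all_boot all_order all_algebra.
From mathcomp Require Import boolp classical_sets functions cardinality.

Set Implicit Arguments.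
Unset Strict Implicit.
Unset Printing Implicit Defensive.

Import GRing.Theory.
Local Open Scope ring_scope.
Local Open Scope classical_set_scope.
Local Open Scope quotient_scope.

Section Tensor.
Variables (k : fieldType) (V W : lmodType k).

Definition tens_sum (U : lmodType k) (f : V -> W -> U) (s : seq (V * W)) : U :=
  \sum_(p <- s) f p.1 p.2.

(* A list of pairs stands for the formal sum of its pure tensors; two formal
   sums are identified when no bilinear map separates them. *)
Definition tens_rel (s t : seq (V * W)) : bool :=
  `[< forall (U : lmodType k) (f : {bilinear V -> W -> U}),
        tens_sum f s = tens_sum f t >].

Lemma tens_rel_refl : reflexive tens_rel.
Proof. by move=> s; apply/asboolP. Qed.

Lemma tens_rel_sym : symmetric tens_rel.
Proof. by move=> s t; apply/asboolP/asboolP => e U f; rewrite e. Qed.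

Lemma tens_rel_trans : transitive tens_rel.
Proof.
by move=> t s u /asboolP e /asboolP e'; apply/asboolP => U f; rewrite e e'.
Qed.

Canonical tens_equiv :=
  EquivRel tens_rel tens_rel_refl tens_rel_sym tens_rel_trans.

Definition tensor := {eq_quot tens_equiv}.
HB.instance Definition _ := Choice.on tensor.
HB.instance Definition _ := EqQuotient.on tensor.

End Tensor.

(* The linear map induced on the tensor product by f, meaningful only when f is
   bilinear: see tlift_linear and tliftE. *)
HB.lock Definition tlift (k : fieldType) (V W U : lmodType k)
    (f : V -> W -> U) (t : tensor V W) : U := tens_sum f (repr t).

Section TensorTheory.
Variables (k : fieldType) (V W : lmodType k).
Local Notation tensor := (tensor V W).

Lemma tlift_pi (U : lmodType k) (f : {bilinear V -> W -> U}) s :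
  tlift f (\pi_tensor s) = tens_sum f s.
Proof.
rewrite tlift.unlock; case: piP => t /eqmodP /asboolP /(_ U f) e.
by rewrite e.
Qed.

Lemma tlift_ext (t u : tensor) :
  (forall (U : lmodType k) (f : {bilinear V -> W -> U}),
     tlift f t = tlift f u) -> t = u.
Proof.
move=> e; rewrite -[t]reprK -[u]reprK; apply/eqmodP/asboolP => U f.
by have := e U f; rewrite tlift.unlock.
Qed.

Definition tens_zero : tensor := \pi_tensor [::].
Definition tens_add (t u : tensor) : tensor := \pi_tensor (repr t ++ repr u).
Definition tens_opp (t : tensor) : tensor :=
  \pi_tensor [seq (- p.1, p.2) | p <- repr t].
Definition tens_scale (a : k) (t : tensor) : tensor :=
  \pi_tensor [seq (a *: p.1, p.2) | p <- repr t].

Section TliftOps.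
Variables (U : lmodType k) (f : {bilinear V -> W -> U}).

Lemma tlift_zero : tlift f tens_zero = 0.
Proof. by rewrite tlift_pi /tens_sum big_nil. Qed.

Lemma tlift_add t u : tlift f (tens_add t u) = tlift f t + tlift f u.
Proof. by rewrite tlift_pi tlift.unlock /tens_sum big_cat. Qed.

Lemma tlift_opp t : tlift f (tens_opp t) = - tlift f t.
Proof.
rewrite tlift_pi tlift.unlock /tens_sum big_map -sumrN.
by apply: eq_bigr => p _; rewrite linearNl.
Qed.

Lemma tlift_scale a t : tlift f (tens_scale a t) = a *: tlift f t.
Proof.
rewrite tlift_pi tlift.unlock /tens_sum big_map scaler_sumr.
by apply: eq_bigr => p _; rewrite linearZl_LR.
Qed.

End TliftOps.

Definition tliftS := (tlift_zero, tlift_add, tlift_opp, tlift_scale).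

Lemma tens_addA : associative tens_add.
Proof. by move=> s t u; apply: tlift_ext => U f; rewrite !tliftS addrA. Qed.

Lemma tens_addC : commutative tens_add.
Proof. by move=> s t; apply: tlift_ext => U f; rewrite !tliftS addrC. Qed.

Lemma tens_add0 : left_id tens_zero tens_add.
Proof. by move=> s; apply: tlift_ext => U f; rewrite !tliftS add0r. Qed.

Lemma tens_addN : left_inverse tens_zero tens_opp tens_add.
Proof. by move=> s; apply: tlift_ext => U f; rewrite !tliftS addNr. Qed.

HB.instance Definition _ :=
  GRing.isZmodule.Build tensor tens_addA tens_addC tens_add0 tens_addN.

Lemma tens_scaleA a b t : tens_scale a (tens_scale b t) = tens_scale (a * b) t.
Proof. by apply: tlift_ext => U f; rewrite !tliftS scalerA. Qed.

Lemma tens_scale1 : left_id 1 tens_scale.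
Proof. by move=> t; apply: tlift_ext => U f; rewrite !tliftS scale1r. Qed.

Lemma tens_scaleDr : right_distributive tens_scale +%R.
Proof.
by move=> a s t; apply: tlift_ext => U f; rewrite !tliftS scalerDr.
Qed.

Lemma tens_scaleDl t : {morph tens_scale^~ t : a b / a + b}.
Proof.
by move=> a b; apply: tlift_ext => U f; rewrite !tliftS scalerDl.
Qed.

HB.instance Definition _ := GRing.Zmodule_isLmodule.Build k tensor
  tens_scaleA tens_scale1 tens_scaleDr tens_scaleDl.

Definition tens (x : V) (y : W) : tensor := \pi_tensor [:: (x, y)].

Lemma tlift_tens (U : lmodType k) (f : {bilinear V -> W -> U}) x y :
  tlift f (tens x y) = f x y.
Proof. by rewrite tlift_pi /tens_sum big_seq1. Qed.

Lemma tens_bilinear : bilinear_for *:%R *:%R tens.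
Proof.
split=> [y a x x'|x a y y']; apply: tlift_ext => U f;
  rewrite tlift_add tlift_scale !tlift_tens ?linearPl ?linearPr //.
Qed.

HB.instance Definition _ :=
  bilinear_isBilinear.Build k V W tensor *:%R *:%R tens tens_bilinear.

Section Universal.
Variables (U : lmodType k) (f : V -> W -> U).
Hypothesis hf : bilinear_for *:%R *:%R f.

HB.instance Definition _ :=
  bilinear_isBilinear.Build k V W U *:%R *:%R f hf.

Lemma tlift_linear : linear (tlift f).
Proof. by move=> a s t; rewrite [LHS]tlift_add tlift_scale. Qed.

Definition tlift_lin : {linear tensor -> U} :=
  HB.pack (tlift f) (GRing.isLinear.Build k tensor U *:%R (tlift f) tlift_linear).

Lemma tliftE x y : tlift f (tens x y) = f x y.
Proof. exact: tlift_tens. Qed.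

End Universal.

Lemma eq_tlift (U : lmodType k) (f g : V -> W -> U) :
  (forall x y, f x y = g x y) -> tlift f =1 tlift g.
Proof.
by move=> e t; rewrite tlift.unlock /tens_sum; apply: eq_bigr => p _; apply: e.
Qed.

Lemma tensorE (t : tensor) : t = \sum_(p <- repr t) tens p.1 p.2.
Proof.
apply: tlift_ext => U f.
have lf : linear (tlift f) by move=> a s u; rewrite [LHS]tlift_add tlift_scale.
pose l := GRing.isLinear.Build k tensor U *:%R (tlift f) lf.
pose g : {linear tensor -> U} := HB.pack (tlift f) l.
have -> : tlift f t = tens_sum f (repr t) by rewrite tlift.unlock.
rewrite -[RHS]/(g _) linear_sum /=.
by apply: eq_bigr => p _; rewrite tlift_tens.
Qed.

Lemma tensor_ext (U : lmodType k) (f g : {linear tensor -> U}) :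
  (forall x y, f (tens x y) = g (tens x y)) -> f =1 g.
Proof.
move=> e t; rewrite (tensorE t) !linear_sum.
by apply: eq_bigr => p _; apply: e.
Qed.

End TensorTheory.

Notation "x \ox y" := (tens x y) (at level 40, left associativity).

Section Functoriality.
Variable k : fieldType.

Definition tmap (V V' W W' : lmodType k) (f : V -> V') (g : W -> W') :
    tensor V W -> tensor V' W' :=
  tlift (fun x y => f x \ox g y).

Section TmapLinear.
Variables (V V' W W' : lmodType k) (f : {linear V -> V'}) (g : {linear W -> W'}).

Lemma tmap_bilinear : bilinear_for *:%R *:%R (fun x y => f x \ox g y).
Proof. by split=> [y a x x'|x a y y'] /=; rewrite linearP ?linearPl ?linearPr. Qed.

Lemma tmapE x y : tmap f g (x \ox y) = f x \ox g y.
Proof. exact: (tliftE tmap_bilinear). Qed.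

HB.instance Definition _ := GRing.isLinear.Build k (tensor V W) (tensor V' W')
  *:%R (tmap f g) (tlift_linear tmap_bilinear).

End TmapLinear.

Section Tassoc.
Variables U V W : lmodType k.

Lemma tens_linear (u : U) : linear (@tens k U V u).
Proof. by move=> a x y; rewrite linearPr. Qed.

HB.instance Definition _ (u : U) :=
  GRing.isLinear.Build k V (tensor U V) *:%R (@tens k U V u) (tens_linear u).

Definition tassoc : tensor (tensor U V) W -> tensor U (tensor V W) :=
  tlift (fun t w => tlift (fun u v => u \ox (v \ox w)) t).

Lemma tassoc_in (w : W) :
  bilinear_for *:%R *:%R (fun (u : U) (v : V) => u \ox (v \ox w)).
Proof. by split=> [v a u u'|u a v v']; rewrite ?linearPl ?linearPr. Qed.

Lemma tassoc_out : bilinear_for *:%R *:%R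
  (fun (t : tensor U V) (w : W) => tlift (fun u v => u \ox (v \ox w)) t).
Proof.
split=> [w|t a w w']; first exact: (tlift_linear (tassoc_in w)).
rewrite tlift.unlock /tens_sum /= scaler_sumr -big_split; apply: eq_bigr => p _ /=.
by rewrite !linearPr.
Qed.

Lemma tassocE u v w : tassoc (u \ox v \ox w) = u \ox (v \ox w).
Proof. by rewrite /tassoc (tliftE tassoc_out) (tliftE (tassoc_in w)). Qed.

HB.instance Definition _ := GRing.isLinear.Build k
  (tensor (tensor U V) W) (tensor U (tensor V W)) *:%R tassoc
  (tlift_linear tassoc_out).

Definition tassocV : tensor U (tensor V W) -> tensor (tensor U V) W :=
  tlift (fun u d => tmap (tens u) idfun d).

Lemma tassocV_bilinear : bilinear_for *:%R *:%R
  (fun (u : U) (d : tensor V W) => tmap (tens u) (idfun : W -> W) d).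
Proof.
split=> [d a u u'|u a d d']; last by rewrite linearP.
rewrite /tmap tlift.unlock /tens_sum /= scaler_sumr -big_split.
by apply: eq_bigr => p _ /=; rewrite !linearPl.
Qed.

HB.instance Definition _ := GRing.isLinear.Build k
  (tensor U (tensor V W)) (tensor (tensor U V) W) *:%R tassocV
  (tlift_linear tassocV_bilinear).

Lemma tassocVE u d : tassocV (u \ox d) = tmap (tens u) idfun d.
Proof. exact: (tliftE tassocV_bilinear). Qed.

End Tassoc.

(* The image of A (x) B in V (x) W, for subspaces A of V and B of W. *)
Definition tens_sub (V W : lmodType k) (A : set V) (B : set W) :
    set (tensor V W) :=
  [set t | exists s : seq (V * W),
     (forall p, p \in s -> A p.1 /\ B p.2) /\ t = \sum_(p <- s) p.1 \ox p.2].

End Functoriality.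

HB.mixin Record isCoalgebra (k : fieldType) C of GRing.Lmodule k C := {
  comul : {linear C -> tensor C C};
  counit : {linear C -> k | *%R};
  comulA : forall x : C,
    tassoc (tmap comul idfun (comul x)) = tmap idfun comul (comul x);
  counitl : forall x : C, tlift (fun a b => counit a *: b) (comul x) = x;
  counitr : forall x : C, tlift (fun a b => counit b *: a) (comul x) = x
}.

#[short(type="coalgType")]
HB.structure Definition Coalgebra (k : fieldType) :=
  {C of GRing.Lmodule k C & isCoalgebra k C}.

(* The product (a (x) b) (c (x) d) = ac (x) bd of the algebra A (x) B. *)
Definition tmul (k : fieldType) (A B : algType k) (s t : tensor A B) :
    tensor A B :=
  tlift (fun a b => tlift (fun c d => (a * c) \ox (b * d)) t) s.

HB.mixin Record isHopf (k : fieldType) A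
    of GRing.Algebra k A & Coalgebra k A := {
  antipode : {linear A -> A};
  comul1 : comul (1 : A) = 1 \ox 1;
  comulM : forall x y : A, comul (x * y) = tmul (comul x) (comul y);
  counit1 : counit (1 : A) = 1;
  counitM : forall x y : A, counit (x * y) = counit x * counit y;
  antipodel : forall x : A,
    tlift (fun a b => antipode a * b) (comul x) = (counit x)%:A;
  antipoder : forall x : A,
    tlift (fun a b => a * antipode b) (comul x) = (counit x)%:A
}.

#[short(type="hopfAlgType")]
HB.structure Definition Hopf (k : fieldType) :=
  {A of GRing.Algebra k A & Coalgebra k A & isHopf k A}.

Record comod (k : fieldType) (C : coalgType k) := Comod {
  comod_sort :> lmodType k;
  coact : {linear comod_sort -> tensor comod_sort C};
  coactA : forall m,
    tassoc (tmap coact idfun (coact m)) = tmap idfun comul (coact m);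
  coact_counit : forall m, tlift (fun n c => counit c *: n) (coact m) = m
}.
Arguments coact {k C} M : rename.

Record comodHom (k : fieldType) (C : coalgType k) (M N : comod C) := ComodHom {
  comod_hom :> {linear M -> N};
  comod_homP : forall m, coact N (comod_hom m) = tmap comod_hom idfun (coact M m)
}.

Section Comodules.
Variables (k : fieldType) (C : coalgType k).
Implicit Types M N : comod C.

Definition hom_neq0 M N := exists (f : comodHom M N) (m : M), f m != 0.

Definition comod_iso M N :=
  exists (f : comodHom M N) (g : comodHom N M), cancel f g /\ cancel g f.

Definition comod_summand N M :=
  exists (i : comodHom N M) (p : comodHom M N), cancel i p.

Definition subspace (V : lmodType k) (A : set V) :=
  A 0 /\ forall a x y, A x -> A y -> A (a *: x + y).

Definition subcomod M (A : set M) :=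
  subspace A /\ forall m, A m -> tens_sub A setT (coact M m).

Definition simple_subcomod M (A : set M) :=
  [/\ subcomod A, A <> [set 0] &
      forall B : set M, subcomod B -> B `<=` A -> B = [set 0] \/ B = A].

Definition simple_comod M := simple_subcomod (@setT M).

Definition semisimple_comod M := forall m : M, exists s : seq M,
  m = \sum_(x <- s) x /\
  forall x, x \in s -> exists A : set M, simple_subcomod A /\ A x.

Record simpleComod := SimpleComod {
  simple_sort :> comod C;
  simpleP : simple_comod simple_sort
}.

(* The isomorphism classes of simple comodules.  Collections of comodules are
   predicates rather than sets because comodules form too large a type for the
   universe of set. *)
Definition irrep : Type :=
  {A : simpleComod -> Prop |
     exists V : simpleComod, A = (fun V' => comod_iso V V')}.

(* An arbitrary representative of an isomorphism class. *)
Definition irrep_repr (A : irrep) : simpleComod := sval (cid (svalP A)).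

Definition constituents M (W : irrep) : Prop := comod_summand (irrep_repr W) M.

End Comodules.
Coercion irrep_repr : irrep >-> simpleComod.

Definition cosemisimple (k : fieldType) (C : coalgType k) :=
  forall M : comod C, semisimple_comod M.

Section Complement.
Variable k : fieldType.

Lemma subspace_complement (V : lmodType k) (A : set V) : subspace A ->
  exists B : set V, [/\ subspace B, A `&` B `<=` [set 0] &
    forall x, exists2 a, A a & B (x - a)].
Proof.
move=> [A0 Al].
pose P (B : set V) := (forall a x y, B x -> B y -> B (a *: x + y)) /\
  A `&` B `<=` [set 0].
have [|B [[Bl AB] Bmax]] := @Zorn_bigcup V P.
  move=> F FP Ftot; split=> [a x y [X FX Xx] [Y FY Yy]|x [Ax [X FX Xx]]].
    have [XY|YX] := Ftot _ _ FX FY.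
      by exists Y => //; apply: (FP _ FY).1 => //; apply: XY.
    by exists X => //; apply: (FP _ FX).1 => //; apply: YX.
  by apply: (FP _ FX).2.
have B0 : B 0.
  have [[b Bb]|nB] := pselect (exists b, B b).
    by rewrite -(addNr b) -scaleN1r; apply: Bl.
  have nB' b : ~ B b by move=> Bb; apply: nB; exists b.
  exfalso; apply: (Bmax [set 0]).
    by split=> [b /nB'//|]; move=> /(_ 0 erefl) /nB'.
  split=> [a x y -> ->|x [_ ->]//].
  by rewrite scaler0 addr0.
exists B; split=> // x.
have [[a Aa Ba]|nx] := pselect (exists2 a, A a & B (x - a)); first by exists a.
exfalso; apply: (Bmax [set y | exists c, B (y - c *: x)]).
  split=> [y By|sub]; first by exists 0; rewrite scale0r subr0.
  apply: nx; exists 0 => //; rewrite subr0; apply: sub.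
  by exists 1; rewrite scale1r subrr.
split=> [a y z [c Bc] [d Bd]|y [Ay [c Bc]]].
  exists (a * c + d).
  suff -> : a *: y + z - (a * c + d) *: x =
            a *: (y - c *: x) + (z - d *: x) by apply: Bl.
  by rewrite scalerBr scalerDl scalerA addrACA opprD.
have [c0|c0] := eqVneq c 0.
  by apply: AB; split=> //; move: Bc; rewrite c0 scale0r subr0.
exfalso; apply: nx; exists (c^-1 *: y).
  by rewrite -[_ *: y]addr0; apply: Al.
suff -> : x - c^-1 *: y = (- c^-1) *: (y - c *: x) + 0 by apply: Bl.
by rewrite addr0 scalerBr !scaleNr opprK scalerA mulVf // scale1r addrC.
Qed.

Lemma subspace_proj (V : lmodType k) (A : set V) : subspace A ->
  exists p : {linear V -> V}, (forall x, A (p x)) /\ forall x, A x -> p x = x.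
Proof.
move=> sA; have [B [[B0 Bl] AB ex]] := subspace_complement sA.
have [A0 Al] := sA.
pose p x := s2val (cid2 (ex x)).
have Ap x : A (p x) := s2valP (cid2 (ex x)).
have Bp x : B (x - p x) := s2valP' (cid2 (ex x)).
have pu x a : A a -> B (x - a) -> p x = a.
  move=> Aa Ba; apply/subr0_eq; apply: AB; split.
    by rewrite addrC -scaleN1r; apply: Al.
  suff -> : p x - a = (-1) *: (x - p x) + (x - a) by apply: Bl.
  by rewrite scaleN1r opprB addrA subrK.
have lp : linear p.
  move=> a x y; apply: pu; first exact: Al.
  suff -> : a *: x + y - (a *: p x + p y) = a *: (x - p x) + (y - p y).
    exact: Bl.
  by rewrite scalerBr addrACA opprD.
pose l := GRing.isLinear.Build k V V *:%R p lp.
pose q : {linear V -> V} := HB.pack p l.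
by exists q; split=> [x|x Ax] //=; apply: pu => //; rewrite subrr.
Qed.

Lemma ker_subspace (V X : lmodType k) (f : {linear V -> X}) :
  subspace [set x | f x = 0].
Proof.
split=> [|a x y /= fx fy]; first exact: linear0.
by rewrite linearP fx fy scaler0 addr0.
Qed.

Lemma tmap_ker (V X C : lmodType k) (f : {linear V -> X}) (t : tensor V C) :
  tmap f idfun t = 0 -> tens_sub [set x | f x = 0] setT t.
Proof.
move=> ft.
have sK := ker_subspace f.
have sI : subspace (range f).
  split=> [|a _ _ [x _ <-] [y _ <-]]; first by exists 0; rewrite ?linear0.
  by exists (a *: x + y) => //; rewrite linearP.
have [p [Kp pK]] := subspace_proj sK.
have [r [Ir rI]] := subspace_proj sI.
have ex y : exists x, f x = r y by case: (Ir y) => x _ <-; exists x.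
pose g0 y := sval (cid (ex y)).
have fg y : f (g0 y) = r y := svalP (cid (ex y)).
pose g y := g0 y - p (g0 y).
have swap (a b c d : V) : a - b = c - d -> c - a = d - b.
  by move=> e; apply/eqP; rewrite subr_eq -addrA [- b + a]addrC e addrC subrK.
have gf x : g (f x) = x - p x.
  have : p (g0 (f x) - x) = g0 (f x) - x.
    by apply: pK; rewrite /= linearB fg rI ?subrr //; exists x.
  by rewrite linearB => /swap.
have lg : linear g.
  move=> a x y; pose z := g0 (a *: x + y) - (a *: g0 x + g0 y).
  have : p z = z.
    by apply: pK; rewrite /= /z linearB fg [r _]linearP [f (_ + _)]linearP !fg subrr.
  rewrite /z linearB linearP => /swap; rewrite -/(g _) => ->.
  by rewrite scalerBr addrACA -opprD.
pose l := GRing.isLinear.Build k X V *:%R g lg.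
pose h : {linear X -> V} := HB.pack g l.
have e : t - tmap p idfun t = tmap h idfun (tmap f idfun t).
  pose F : {linear tensor V C -> tensor V C} := idfun \- tmap p idfun.
  pose G : {linear tensor V C -> tensor V C} := tmap h idfun \o tmap f idfun.
  apply: (@tensor_ext _ _ _ _ F G) => x y.
  rewrite -[F _]/(x \ox y - tmap p idfun (x \ox y)).
  by rewrite -[G _]/(tmap h _ (tmap f _ _)) !tmapE -[h _]/(g _) gf linearBl.
move: e; rewrite ft linear0 => /subr0_eq ->.
rewrite (tensorE t) linear_sum.
exists [seq (p q.1, q.2) | q <- repr t]; split.
  by move=> _ /mapP [q _ ->]; split=> //; apply: Kp.
by rewrite big_map; apply: eq_bigr => q _; exact: tmapE.
Qed.

End Complement.

Section TmapTheory.
Variable k : fieldType.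

Lemma eq_tmap (V V' W W' : lmodType k) (f f' : V -> V') (g g' : W -> W') :
  f =1 f' -> g =1 g' -> tmap f g =1 tmap f' g'.
Proof. by move=> ef eg; apply: eq_tlift => x y; rewrite ef eg. Qed.

Lemma tmap_comp (V V' V'' W W' W'' : lmodType k)
    (f : {linear V' -> V''}) (f' : {linear V -> V'})
    (g : {linear W' -> W''}) (g' : {linear W -> W'}) (t : tensor V W) :
  tmap f g (tmap f' g' t) = tmap (f \o f') (g \o g') t.
Proof.
apply: (@tensor_ext _ _ _ _ (tmap f g \o tmap f' g')
                            (tmap (f \o f') (g \o g'))) => x y.
rewrite -[LHS]/(tmap f g (tmap f' g' _)) !tmapE.
by rewrite -[RHS]/(tmap (f \o f') (g \o g') (x \ox y)) [RHS]tmapE.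
Qed.

Lemma tmap_id (V W : lmodType k) (t : tensor V W) : tmap idfun idfun t = t.
Proof.
apply: (@tensor_ext _ _ _ _ (tmap idfun idfun) idfun) => x y; exact: tmapE.
Qed.

Lemma tensor_ext3 (U V W X : lmodType k)
    (f g : {linear tensor (tensor U V) W -> X}) :
  (forall u v w, f (u \ox v \ox w) = g (u \ox v \ox w)) -> f =1 g.
Proof.
move=> e; apply: tensor_ext => s w; rewrite (tensorE s) linear_sumlz !linear_sum.
by apply: eq_bigr => p _; exact: e.
Qed.

Lemma tassoc_tmap (U U' V V' W W' : lmodType k) (f : {linear U -> U'})
    (g : {linear V -> V'}) (h : {linear W -> W'}) t :
  tassoc (tmap (tmap f g) h t) = tmap f (tmap g h) (tassoc t).
Proof.
apply: (@tensor_ext3 _ _ _ _ (@tassoc _ _ _ _ \o tmap (tmap f g) h)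
                             (tmap f (tmap g h) \o @tassoc _ _ _ _)) => u v w.
rewrite -[LHS]/(tassoc (tmap _ _ _)) -[RHS]/(tmap _ _ (tassoc _)) tassocE.
rewrite !tmapE -[X in tassoc (X \ox _)]/(tmap f g _).
by rewrite -[X in _ = _ \ox X]/(tmap g h _) !tmapE tassocE.
Qed.

Lemma tassoc_tens (U V W : lmodType k) (u : U) (d : tensor V W) :
  tassoc (tmap (tens u) idfun d) = u \ox d.
Proof.
apply: (@tensor_ext _ _ _ _ (@tassoc _ _ _ _ \o tmap (tens u) idfun) (tens u)).
move=> x y; rewrite -[LHS]/(tassoc (tmap _ _ _)) tmapE.
by rewrite -[RHS]/(_ \ox (_ \ox _)) tassocE.
Qed.

Lemma tassocVK (U V W : lmodType k) :
  cancel (@tassocV _ U V W) (@tassoc _ U V W).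
Proof.
apply: (@tensor_ext _ _ _ _ (@tassoc _ _ _ _ \o @tassocV _ _ _ _) idfun) => u d.
by rewrite -[LHS]/(tassoc (tassocV _)) tassocVE tassoc_tens.
Qed.

Lemma tassocK (U V W : lmodType k) :
  cancel (@tassoc _ U V W) (@tassocV _ U V W).
Proof.
apply: (@tensor_ext3 _ _ _ _ (@tassocV _ _ _ _ \o @tassoc _ _ _ _) idfun).
move=> u v w.
by rewrite -[LHS]/(tassocV (tassoc _)) tassocE tassocVE tmapE.
Qed.

Lemma tassocV_tmap (U U' V V' W W' : lmodType k) (f : {linear U -> U'})
    (g : {linear V -> V'}) (h : {linear W -> W'}) t :
  tassocV (tmap f (tmap g h) t) = tmap (tmap f g) h (tassocV t).
Proof. by rewrite -[t]tassocVK -tassoc_tmap !tassocK. Qed.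

Lemma counit_bilinear (C : coalgType k) (M : lmodType k) :
  bilinear_for *:%R *:%R (fun (m : M) (c : C) => counit c *: m).
Proof.
split=> [c a m m'|m a c c']; first by rewrite linearP.
by rewrite linearP scalerDl -scalerA.
Qed.

Lemma counit_tmap (C : coalgType k) (M N : lmodType k) (f : {linear M -> N})
    (t : tensor M C) :
  f (tlift (fun m c => counit c *: m) t) =
  tlift (fun n c => counit c *: n) (tmap f idfun t).
Proof.
pose eM := tlift_lin (counit_bilinear C M).
pose eN := tlift_lin (counit_bilinear C N).
apply: (@tensor_ext _ _ _ _ (f \o eM) (eN \o tmap f idfun)) => m c.
rewrite -[LHS]/(f (tlift _ _)) -[RHS]/(tlift _ (tmap f idfun _)) tmapE.
by rewrite (tliftE (counit_bilinear C M)) (tliftE (counit_bilinear C N)) linearZ.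
Qed.

End TmapTheory.

Section Subcomodule.
Variables (k : fieldType) (C : coalgType k) (M : comod C) (A : set M).

Definition subcomod_sort of subcomod A : Type := {x : M | `[< A x >]}.
Variable hA : subcomod A.
Local Notation N := (subcomod_sort hA).
HB.instance Definition _ := SubType.on N.
HB.instance Definition _ := [Choice of N by <:].

Lemma subcomod_closed : subsemimod_closed [pred x : M | `[< A x >]].
Proof.
have [[A0 Al] _] := hA.
split; [split; first exact/asboolP|] => [x y|a x] /asboolP Ax.
  by move=> /asboolP Ay; apply/asboolP; rewrite -[x]scale1r; apply: Al.
by apply/asboolP; rewrite -[_ *: x]addr0; apply: Al.
Qed.

HB.instance Definition _ :=
  GRing.SubChoice_isSubLmodule.Build k M _ N subcomod_closed.

Definition subcomod_val : {linear N -> M} := val.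

Let proj_ex := cid (subspace_proj hA.1).

Lemma subcomod_retr_subproof x : `[< A (sval proj_ex x) >].
Proof. exact/asboolP/(svalP proj_ex).1. Qed.

(* An arbitrary linear retraction of M onto its subcomodule. *)
Definition subcomod_retr (x : M) : N :=
  exist _ (sval proj_ex x) (subcomod_retr_subproof x).

Lemma subcomod_retr_linear : linear subcomod_retr.
Proof. by move=> a x y; apply: val_inj; rewrite [LHS]linearP linearP. Qed.

HB.instance Definition _ :=
  GRing.isLinear.Build k M N *:%R subcomod_retr subcomod_retr_linear.

Lemma subcomod_valP n : A (subcomod_val n).
Proof. exact: asboolW (valP n). Qed.

Lemma subcomod_retr_val n : A n -> subcomod_val (subcomod_retr n) = n.
Proof. exact: (svalP proj_ex).2. Qed.

Lemma subcomod_valK : cancel subcomod_val subcomod_retr.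
Proof. by move=> n; apply: val_inj; apply: subcomod_retr_val (subcomod_valP n). Qed.

Lemma tmap_subcomod_inj (W : lmodType k) :
  injective (tmap subcomod_val (idfun : W -> W)).
Proof.
apply: (can_inj (g := tmap subcomod_retr idfun)) => t.
rewrite tmap_comp -[RHS]tmap_id.
by apply: eq_tmap => // x; apply: subcomod_valK.
Qed.

(* By subcomod_coactE this is the restriction of the coaction of M; it does not
   depend on the retraction, by tmap_subcomod_inj. *)
Definition subcomod_coact : {linear N -> tensor N C} :=
  tmap subcomod_retr idfun \o (coact M \o subcomod_val).

Lemma subcomod_coactE n :
  tmap subcomod_val idfun (subcomod_coact n) = coact M (subcomod_val n).
Proof.
have [s [sA e]] := hA.2 _ (subcomod_valP n).
rewrite -[subcomod_coact n]/(tmap subcomod_retr _ (coact M (subcomod_val n))) e.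
rewrite !linear_sum [LHS]big_seq [RHS]big_seq; apply: eq_bigr => p ps.
by rewrite -[LHS]/(tmap _ _ (tmap _ _ _)) !tmapE subcomod_retr_val //; exact: (sA _ ps).1.
Qed.

Lemma subcomod_coactA n :
  tassoc (tmap subcomod_coact idfun (subcomod_coact n)) =
  tmap idfun comul (subcomod_coact n).
Proof.
apply: tmap_subcomod_inj.
rewrite (eq_tmap (f' := subcomod_val) (g' := tmap idfun idfun) (frefl _)); last first.
  by move=> t; rewrite tmap_id.
rewrite -tassoc_tmap tmap_comp.
rewrite (eq_tmap (f' := coact M \o subcomod_val) (g' := idfun \o idfun)) //;
  last exact: subcomod_coactE.
rewrite -(tmap_comp _ subcomod_val idfun idfun) subcomod_coactE coactA.
rewrite -subcomod_coactE !tmap_comp.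
by apply: eq_tmap => // x; rewrite /= tmap_id.
Qed.

Lemma subcomod_coact_counit n :
  tlift (fun x c => counit c *: x) (subcomod_coact n) = n.
Proof.
apply: val_inj; rewrite -[LHS]/(subcomod_val _) counit_tmap subcomod_coactE.
by rewrite coact_counit.
Qed.

Definition subcomodule : comod C := Comod subcomod_coactA subcomod_coact_counit.

End Subcomodule.

Section Cofree.
Variables (k : fieldType) (C : coalgType k) (V : lmodType k).

(* The comodule V (x) C with coaction id (x) comul. *)
Definition cofree_coact : {linear tensor V C -> tensor (tensor V C) C} :=
  @tassocV _ _ _ _ \o tmap idfun comul.

Lemma cofree_coactE v c : cofree_coact (v \ox c) = tmap (tens v) idfun (comul c).
Proof. by rewrite -[LHS]/(tassocV (tmap _ _ _)) tmapE tassocVE. Qed.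

Lemma cofree_coactA t :
  tassoc (tmap cofree_coact idfun (cofree_coact t)) =
  tmap idfun comul (cofree_coact t).
Proof.
apply: (@tensor_ext _ _ _ _
  (@tassoc _ _ _ _ \o (tmap cofree_coact idfun \o cofree_coact))
  (tmap idfun comul \o cofree_coact)) => v c.
rewrite -[LHS]/(tassoc (tmap _ _ (cofree_coact _))).
rewrite -[RHS]/(tmap _ _ (cofree_coact _)) cofree_coactE !tmap_comp.
rewrite (eq_tmap (f' := tmap (tens v) idfun \o comul)
  (g' := idfun \o idfun)) //; last exact: cofree_coactE.
rewrite -(tmap_comp _ comul idfun idfun) tassoc_tmap comulA tmap_comp.
by apply: eq_tmap => // x; rewrite /= tmap_id.
Qed.

Lemma cofree_coact_counit t :
  tlift (fun x c => counit c *: x) (cofree_coact t) = t.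
Proof.
pose e := tlift_lin (counit_bilinear C (tensor V C)).
apply: (@tensor_ext _ _ _ _ (e \o cofree_coact) idfun) => v c.
rewrite -[LHS]/(tlift _ (cofree_coact _)) cofree_coactE -counit_tmap.
by rewrite counitr.
Qed.

Definition cofree : comod C := Comod cofree_coactA cofree_coact_counit.

End Cofree.

Record hopfMor (k : fieldType) (A B : hopfAlgType k) := HopfMor {
  hopf_mor :> {lrmorphism A -> B};
  hopf_mor_comul : forall x,
    comul (hopf_mor x) = tmap hopf_mor hopf_mor (comul x);
  hopf_mor_counit : forall x, counit (hopf_mor x) = counit x;
  hopf_mor_antipode : forall x, antipode (hopf_mor x) = hopf_mor (antipode x)
}.

Section ResInd.
Variables (k : fieldType) (OG OH : hopfAlgType k) (pi : hopfMor OG OH).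

Section Res.
Variable V : comod OG.

Definition res_coact : {linear V -> tensor V OH} := tmap idfun pi \o coact V.

Lemma res_coactA v :
  tassoc (tmap res_coact idfun (res_coact v)) = tmap idfun comul (res_coact v).
Proof.
rewrite -[res_coact v]/(tmap idfun pi (coact V v)) !tmap_comp.
rewrite (eq_tmap (f' := tmap idfun pi \o coact V) (g' := pi \o idfun)) //.
rewrite -(tmap_comp _ (coact V) _ idfun) tassoc_tmap coactA tmap_comp.
by apply: eq_tmap => // x; rewrite /= hopf_mor_comul.
Qed.

Lemma res_coact_counit v :
  tlift (fun x c => counit c *: x) (res_coact v) = v.
Proof.
rewrite -[RHS](coact_counit v).
pose e := tlift_lin (counit_bilinear OG V).
pose e' := tlift_lin (counit_bilinear OH V).
apply: (@tensor_ext _ _ _ _ (e' \o tmap idfun pi) e) => x c.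
rewrite -[LHS]/(tlift _ (tmap _ _ _)) -[RHS]/(tlift _ _) tmapE.
by rewrite (tliftE (counit_bilinear _ _)) (tliftE (counit_bilinear _ _))
  hopf_mor_counit.
Qed.

Definition Res : comod OH := Comod res_coactA res_coact_counit.

End Res.

Section Ind.
Variable W : comod OH.

Definition left_coact : {linear OG -> tensor OH OG} := tmap pi idfun \o comul.

Definition cotensor : set (cofree OG W) :=
  [set z | tassoc (tmap (coact W) idfun z) = tmap idfun left_coact z].

Let shift : {linear tensor W (tensor OH OG) ->
                    tensor (tensor W (tensor OH OG)) OG} :=
  @tassocV _ _ _ _ \o tmap idfun (cofree_coact OG OH).

Lemma cotensor_shiftl z :
  tmap (@tassoc _ _ _ _ \o tmap (coact W) idfun) idfun (cofree_coact OG W z) =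
  shift (tassoc (tmap (coact W) idfun z)).
Proof.
rewrite -(tmap_comp _ _ idfun idfun).
have -> : tmap (tmap (coact W) idfun) idfun (cofree_coact OG W z) =
          cofree_coact OG (tensor W OH) (tmap (coact W) idfun z).
  rewrite -[cofree_coact OG W z]/(tassocV (tmap _ _ z)) -tassocV_tmap.
  rewrite -[RHS]/(tassocV (tmap _ _ (tmap _ _ z))) !tmap_comp; congr tassocV.
  by apply: eq_tmap => // x; rewrite /= tmap_id.
move: (tmap _ _ z) => {z}.
apply: (@tensor_ext3 _ _ _ _ _
  (tmap (@tassoc _ _ _ _) idfun \o cofree_coact OG (tensor W OH))
  (shift \o @tassoc _ W OH OG)) => w h g.
rewrite -[LHS]/(tmap _ _ (cofree_coact _ _ _)) cofree_coactE tmap_comp.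
rewrite -[RHS]/(tassocV (tmap _ _ (tassoc _))) tassocE tmapE tassocVE.
rewrite cofree_coactE tmap_comp; apply: eq_tmap => // x; exact: tassocE.
Qed.

Lemma cotensor_shiftr z :
  tmap (tmap idfun left_coact) idfun (cofree_coact OG W z) =
  shift (tmap idfun left_coact z).
Proof.
apply: (@tensor_ext _ _ _ _
  (tmap (tmap idfun left_coact) idfun \o cofree_coact _ _)
  (shift \o tmap idfun left_coact)) => w g.
rewrite -[LHS]/(tmap _ _ (cofree_coact _ _ _)) cofree_coactE tmap_comp.
rewrite -[RHS]/(tassocV (tmap _ _ (tmap _ _ _))) !tmapE tassocVE.
rewrite (eq_tmap (f' := tens w \o left_coact) (g' := idfun \o idfun)) //; last first.
  by move=> x; exact: tmapE.
rewrite -(tmap_comp _ left_coact idfun idfun); congr tmap.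
rewrite -(tmap_comp (tmap pi idfun) comul idfun idfun).
rewrite -[RHS]/(tassocV (tmap _ _ (tmap _ _ _))).
rewrite -[tmap comul _ _]tassocK comulA -tassocV_tmap !tmap_comp.
by congr tassocV; apply: eq_tmap => // x; rewrite /= tmap_id.
Qed.

Lemma cotensor_subcomod : subcomod cotensor.
Proof.
pose F1 : {linear tensor W OG -> tensor W (tensor OH OG)} :=
  @tassoc _ _ _ _ \o tmap (coact W) idfun.
pose F2 : {linear tensor W OG -> tensor W (tensor OH OG)} :=
  tmap idfun left_coact.
pose F : {linear tensor W OG -> tensor W (tensor OH OG)} := F1 \- F2.
have cE : cotensor = [set z | F z = 0].
  apply/seteqP; split=> z /= e; first by apply/eqP; rewrite subr_eq0; apply/eqP.
  exact/subr0_eq.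
split=> [|z]; first by rewrite cE; apply: ker_subspace.
rewrite cE => Fz; apply: tmap_ker.
have -> : tmap F idfun (coact (cofree OG W) z) =
          tmap F1 idfun (cofree_coact OG W z) - tmap F2 idfun (cofree_coact OG W z).
  apply: (@tensor_ext _ _ _ _ (tmap F idfun)
    (tmap F1 idfun \- tmap F2 idfun)) => x c.
  rewrite -[RHS]/(tmap F1 _ _ - tmap F2 _ _) !tmapE.
  rewrite -[X in X \ox _ - _]/(F1 x) -linearBl.
  exact: (tmapE F idfun x c).
rewrite (cotensor_shiftl z : tmap F1 idfun _ = shift (F1 z)).
rewrite (cotensor_shiftr z : tmap F2 idfun _ = shift (F2 z)).
by rewrite -linearB -[F1 z - F2 z]/(F z) Fz linear0.
Qed.

Definition Ind : comod OG := subcomodule cotensor_subcomod.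

End Ind.

End ResInd.

Section Clifford.
Variables (k : fieldType) (OG OH : hopfAlgType k) (pi : hopfMor OG OH).

(* ad_l x = x_1 S(x_3) (x) x_2 and ad_r x = x_2 (x) S(x_1) x_3. *)
Definition ad_l (x : OG) : tensor OG OG :=
  tlift (fun t c => tlift (fun a b => (a * antipode c) \ox b) t)
        (tmap comul idfun (comul x)).

Definition ad_r (x : OG) : tensor OG OG :=
  tlift (fun t c => tlift (fun a b => b \ox (antipode a * c)) t)
        (tmap comul idfun (comul x)).

Definition hopf_ker : set OG := [set x | pi x = 0].

Definition normal_embedding := forall x, hopf_ker x ->
  tens_sub setT hopf_ker (ad_l x) /\ tens_sub hopf_ker setT (ad_r x).

Definition sim (V : irrep OG) (W : irrep OH) : Prop := hom_neq0 (Res pi V) W.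

Definition slice_l (W : irrep OH) (V : irrep OG) : Prop := sim V W.
Definition slice_r (V : irrep OG) (W : irrep OH) : Prop := sim V W.

Definition simG (V V' : irrep OG) : Prop :=
  forall W, constituents (Res pi V) W <-> constituents (Res pi V') W.

End Clifford.

Definition is_equivalence (T : Type) (R : T -> T -> Prop) :=
  [/\ forall x, R x x, forall x y, R x y -> R y x &
      forall x y z, R x y -> R y z -> R x z].

(* The members of the family F are exactly the classes of R. *)
Definition are_classes (I T : Type) (F : I -> T -> Prop) (R : T -> T -> Prop) :=
  (forall i, exists x, forall y, F i y <-> R x y) /\
  (forall x, exists i, forall y, F i y <-> R x y).

Definition finite_pred (T : Type) (P : T -> Prop) :=
  exists (n : nat) (e : 'I_n -> T), forall x, P x -> exists i, x = e i.

(* Main.v *)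
From HB Require Import structures.
Require Import Defs.
From mathcomp Require Import all_boot all_order all_algebra.
From mathcomp Require Import boolp classical_sets.

(** Why the theorem holds. Write A and B for the Hopf algebras of the ambient
    and of the normal quantum group, and pi : A -> B for the surjection.

    Everything but the equivalence of the two definitions of the relation
    (Frobenius reciprocity, [frobenius_fwd] and [frobenius_bwd]) and the
    finiteness of the slices follows formally from three facts: every simple
    V restricts to a comodule with some simple quotient ([sim_exr]), every
    simple W is a quotient of some restriction ([sim_exl]), and two simple
    comodules V, V' whose restrictions share one simple constituent have all
    their constituents in common ([sim_shared]). The last fact is the Clifford
    theorem and the only place where normality is used.

    For a classical normal subgroup H of G one argues that the H-constituents
    of V form one orbit under conjugation by G. Here the replacement for a
    G-stable set of H-constituents is the space E, inside B, of the matrix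
    coefficients of the restriction of V'. It is stable under the right
    adjoint coaction x |-> x_2 (x) S(x_1) x_3 of A, which descends to B by
    normality. The identity x_3 (x) x_1 S(x_2) x_4 = x_1 (x) x_2
    ([twist_ad_r]) then shows that the vectors of V with coefficients in E form
    a subcomodule over A, not merely over B ([isotypic_subcomod]). When V is
    simple and one constituent of its restriction also occurs in V', this
    subcomodule is nonzero, hence is V, and all constituents of V have their
    coefficients in E. By cosemisimplicity of B, a simple comodule with
    coefficients in E occurs in V' ([coef_space_hom]).

    The slices on the side of B are finite because a simple V is spanned by
    the left factors of the coaction of any nonzero vector
    ([simple_comod_span]), so that its restriction is a finite sum of simple
    comodules.

    Subspaces E are carried along as kernels of endomorphisms q, and vectors
    are compared through the slices of tensors by functionals. *)

Set Implicit Arguments.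
Unset Strict Implicit.
Unset Printing Implicit Defensive.

Import GRing.Theory.
Local Open Scope ring_scope.
Local Open Scope classical_set_scope.

(** * Subspaces, functionals and slices of tensors *)

Section LinearAlgebra.
Variable k : fieldType.

Definition lin_of (U V : lmodType k) (f : U -> V) (lf : linear f) :
    {linear U -> V} :=
  HB.pack f (GRing.isLinear.Build k U V *:%R f lf).

Lemma subspaceD (V : lmodType k) (A : set V) x y :
  subspace A -> A x -> A y -> A (x + y).
Proof. by move=> [_ Al] Ax Ay; rewrite -[x]scale1r; apply: Al. Qed.

Lemma subspaceZ (V : lmodType k) (A : set V) a x :
  subspace A -> A x -> A (a *: x).
Proof. by move=> [A0 Al] Ax; rewrite -[_ *: x]addr0; apply: Al. Qed.

Lemma subspaceB (V : lmodType k) (A : set V) x y :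
  subspace A -> A x -> A y -> A (x - y).
Proof.
move=> sA Ax Ay; apply: subspaceD => //.
by rewrite -scaleN1r; apply: subspaceZ.
Qed.

Lemma subspace_sum (V : lmodType k) (A : set V) (I : eqType) (s : seq I)
    (F : I -> V) :
  subspace A -> (forall i, i \in s -> A (F i)) -> A (\sum_(i <- s) F i).
Proof.
move=> sA AF; rewrite big_seq; elim/big_rec: _ => [|i x /AF Ai Ax].
  exact: sA.1.
exact: subspaceD.
Qed.

(** Presenting subspaces as kernels of endomorphisms is what makes tensor
    products of subspaces tractable: by [tens_subP] below, membership in
    A (x) W becomes one linear equation. *)
Lemma subspace_ker (V : lmodType k) (A : set V) : subspace A ->
  exists q : {linear V -> V}, forall x, q x = 0 <-> A x.
Proof.
move=> sA; have [p [Ap pA]] := subspace_proj sA.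
exists (idfun \- p) => x; split=> [/= /subr0_eq ->|Ax] //.
by rewrite /= pA // subrr.
Qed.

(** The map h is g composed with a choice of preimages; over a field it
    extends by zero from the range of f to all of Y. *)
Lemma lin_factor (X Y Z : lmodType k) (f : {linear X -> Y})
    (g : {linear X -> Z}) : (forall x, f x = 0 -> g x = 0) ->
  exists h : {linear Y -> Z}, forall x, h (f x) = g x.
Proof.
move=> fg.
have sI : subspace (range f).
  split=> [|a _ _ [x _ <-] [y _ <-]]; first by exists 0; rewrite ?linear0.
  by exists (a *: x + y) => //; rewrite linearP.
have [r [Ir rI]] := subspace_proj sI.
have ex y : exists x, f x = r y by case: (Ir y) => x _ <-; exists x.
pose s y := sval (cid (ex y)).
have fs y : f (s y) = r y := svalP (cid (ex y)).
have gE x x' : f x = f x' -> g x = g x'.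
  move=> e; apply/subr0_eq; rewrite -linearB; apply: fg.
  by rewrite linearB e subrr.
have lh : linear (g \o s).
  move=> a x y; rewrite /= -linearP; apply: gE.
  by rewrite [RHS]linearP !fs linearP.
by exists (lin_of lh) => x; apply: gE; rewrite fs rI //; exists x.
Qed.

(** Scaling v embeds the field into V, and a linear left inverse of this
    embedding is the functional wanted. *)
Lemma functional_neq0 (V : lmodType k) (v : V) : v != 0 ->
  exists phi : {linear V -> k^o}, phi v != 0.
Proof.
move=> v0.
have lf : linear (fun a : k^o => a *: v).
  by move=> a b c; rewrite scalerDl -scalerA.
have [|h hE] := @lin_factor _ _ _ (lin_of lf) (idfun : {linear k^o -> k^o}).
  move=> a /= /eqP; rewrite scaler_eq0 (negPf v0) orbF; exact: eqP.
exists h; have := hE 1; rewrite /= scale1r => ->; exact: oner_neq0.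
Qed.

Lemma functional_sep (V : lmodType k) (A : set V) x : subspace A -> ~ A x ->
  exists phi : {linear V -> k^o}, phi x != 0 /\ forall y, A y -> phi y = 0.
Proof.
move=> sA nAx; have [q qA] := subspace_ker sA.
have /functional_neq0 [phi phi0] : q x != 0 by apply/eqP => /qA.
exists (phi \o q); split=> // y Ay.
by rewrite /= (qA _).2 // linear0.
Qed.

Lemma lslice_bilinear (V W : lmodType k) (phi : {linear V -> k^o}) :
  bilinear_for *:%R *:%R (fun (v : V) (w : W) => phi v *: w).
Proof.
split=> [w a v v'|v a w w'] /=; first by rewrite linearP scalerDl -scalerA.
by rewrite /= scalerDr !scalerA mulrC.
Qed.

Lemma rslice_bilinear (V W : lmodType k) (eta : {linear W -> k^o}) :
  bilinear_for *:%R *:%R (fun (v : V) (w : W) => eta w *: v).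
Proof.
split=> [w a v v'|v a w w']; first by rewrite /= scalerDr !scalerA mulrC.
by rewrite linearP scalerDl -scalerA.
Qed.

(** Slices (phi (x) id) t and (id (x) eta) t of a tensor. They stand in for
    coordinates with respect to a basis. *)
Definition lslice (V W : lmodType k) (phi : {linear V -> k^o}) :
  {linear tensor V W -> W} := tlift_lin (lslice_bilinear W phi).
Definition rslice (V W : lmodType k) (eta : {linear W -> k^o}) :
  {linear tensor V W -> V} := tlift_lin (rslice_bilinear V eta).

Lemma lsliceE (V W : lmodType k) phi (v : V) (w : W) :
  lslice W phi (v \ox w) = phi v *: w.
Proof. exact: (tliftE (lslice_bilinear W phi)). Qed.

Lemma rsliceE (V W : lmodType k) eta (v : V) (w : W) :
  rslice V eta (v \ox w) = eta w *: v.
Proof. exact: (tliftE (rslice_bilinear V eta)). Qed.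

Lemma lslice_tmap (V W X Y : lmodType k) (f : {linear V -> X})
    (g : {linear W -> Y}) (phi : {linear X -> k^o}) t :
  lslice Y phi (tmap f g t) = g (lslice W (phi \o f) t).
Proof.
apply: (@tensor_ext _ _ _ _ (lslice Y phi \o tmap f g)
  (g \o lslice W (phi \o f))) => v w.
rewrite -[LHS]/(lslice Y phi (tmap _ _ _)) -[RHS]/(g (lslice _ _ _)) tmapE.
by rewrite !lsliceE linearZ.
Qed.

Lemma rslice_tmap (V W X Y : lmodType k) (f : {linear V -> X})
    (g : {linear W -> Y}) (eta : {linear Y -> k^o}) t :
  rslice X eta (tmap f g t) = f (rslice V (eta \o g) t).
Proof.
apply: (@tensor_ext _ _ _ _ (rslice X eta \o tmap f g)
  (f \o rslice V (eta \o g))) => v w.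
rewrite -[LHS]/(rslice X eta (tmap _ _ _)) -[RHS]/(f (rslice _ _ _)) tmapE.
by rewrite !rsliceE linearZ.
Qed.

Lemma lslice_tassoc (U V W : lmodType k) (phi : {linear U -> k^o})
    (t : tensor (tensor U V) W) :
  lslice (tensor V W) phi (tassoc t) = tmap (lslice V phi) idfun t.
Proof.
apply: (@tensor_ext3 _ _ _ _ _ (lslice _ phi \o @tassoc _ _ _ _)
  (tmap (lslice V phi) idfun)) => u v w.
rewrite -[LHS]/(lslice _ phi (tassoc _)) tassocE lsliceE [RHS]tmapE.
by rewrite -[X in _ = X \ox _]/(lslice V phi _) lsliceE linearZl_LR.
Qed.

Lemma rslice_tassoc (U V W : lmodType k) (xi : {linear V -> k^o})
    (eta : {linear W -> k^o}) (t : tensor (tensor U V) W) :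
  rslice U xi (rslice _ eta t) = rslice U (eta \o lslice W xi) (tassoc t).
Proof.
apply: (@tensor_ext3 _ _ _ _ _ (rslice U xi \o rslice _ eta)
  (rslice U (eta \o lslice W xi) \o @tassoc _ _ _ _)) => u v w.
rewrite -[LHS]/(rslice U xi (rslice _ _ _)) -[RHS]/(rslice _ _ (tassoc _)).
transitivity ((eta w * xi v) *: u).
  rewrite rsliceE linearZ -scalerA. congr (_ *: _); exact: rsliceE.
rewrite tassocE rsliceE; congr (_ *: _).
rewrite -[RHS]/(eta (lslice W xi (v \ox w))) lsliceE linearZ; exact: mulrC.
Qed.

(** Write t as a sum of n pure tensors and induct on n. If the last left factor
    v depends linearly on the others, t is a sum of n - 1 pure tensors. If not,
    some functional separates v from the others, and the slice along it forces
    the right factor that goes with v to vanish. *)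
Lemma lslice_eq0 (V W : lmodType k) (t : tensor V W) :
  (forall phi, lslice W phi t = 0) -> t = 0.
Proof.
have [n [v [w ->]]] : exists n (v : 'I_n -> V) (w : 'I_n -> W),
    t = \sum_i v i \ox w i.
  pose s : seq (V * W) := repr t.
  exists (size s), (fun i => (tnth (in_tuple s) i).1).
  by exists (fun i => (tnth (in_tuple s) i).2); rewrite [LHS]tensorE big_tnth.
elim: n v w => [|n IHn] v w; first by rewrite big_ord0.
pose u i := v (widen_ord (leqnSn n) i); pose z i := w (widen_ord (leqnSn n) i).
have -> : \sum_i v i \ox w i = \sum_i u i \ox z i + v ord_max \ox w ord_max.
  by rewrite big_ord_recr.
move=> s0.
pose A : set V := [set x | exists c : 'I_n -> k, x = \sum_i c i *: u i].
have sA : subspace A.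
  split=> [|a _ _ [c ->] [d ->]] /=.
    by exists (fun=> 0); rewrite big1 // => i _; rewrite scale0r.
  exists (fun i => a * c i + d i); rewrite scaler_sumr -big_split.
  by apply: eq_bigr => i _ /=; rewrite scalerDl scalerA.
have [[c vE]|nAv] := pselect (A (v ord_max)).
  have e : \sum_i u i \ox z i + v ord_max \ox w ord_max =
           \sum_i u i \ox (z i + c i *: w ord_max).
    rewrite vE linear_sumlz -big_split; apply: eq_bigr => i _ /=.
    by rewrite linearDr linearZl_LR linearZr_LR.
  by rewrite e; apply: IHn => phi; rewrite -e.
have [phi [phiv phiA]] := functional_sep sA nAv.
have w0 : w ord_max = 0.
  have := s0 phi; rewrite linearD lsliceE linear_sum big1 ?add0r.
    by move/eqP; rewrite scaler_eq0 (negPf phiv) => /eqP.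
  move=> i _; rewrite lsliceE phiA ?scale0r //.
  exists (fun j => (j == i)%:R); rewrite (bigD1 i) //= eqxx scale1r big1 ?addr0 //.
  by move=> j /negPf ->; rewrite scale0r.
rewrite w0 linear0r addr0; apply: IHn => psi.
by have := s0 psi; rewrite w0 linear0r addr0.
Qed.

(** Slicing on both sides commutes, so this follows from [lslice_eq0] and from
    the fact that functionals separate vectors. *)
Lemma rslice_eq0 (V W : lmodType k) (t : tensor V W) :
  (forall eta, rslice V eta t = 0) -> t = 0.
Proof.
move=> t0; apply: lslice_eq0 => phi; apply: contrapT => /eqP/functional_neq0 [eta].
have -> : eta (lslice W phi t) = phi (rslice V eta t).
  rewrite (tensorE t) !linear_sum; apply: eq_bigr => p _.
  by rewrite lsliceE rsliceE !linearZ; exact: mulrC.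
by rewrite t0 linear0 eqxx.
Qed.

Lemma tmapD (V V' W W' : lmodType k) (f : {linear V -> V'})
    (g : {linear W -> W'}) s t : tmap f g (s + t) = tmap f g s + tmap f g t.
Proof. exact: linearD. Qed.

Lemma tmap0 (V V' W W' : lmodType k) (g : {linear W -> W'}) (t : tensor V W) :
  tmap (\0 : V -> V') g t = 0.
Proof.
rewrite (tensorE t) linear_sum big1 // => p _.
by rewrite [LHS]tmapE linear0l.
Qed.

Lemma tmap_compl (V V' V'' W : lmodType k) (f : {linear V' -> V''})
    (f' : {linear V -> V'}) (t : tensor V W) :
  tmap (f \o f') idfun t = tmap f idfun (tmap f' idfun t).
Proof. by rewrite tmap_comp; apply: eq_tmap. Qed.

Lemma tmap_compr (V W W' W'' : lmodType k) (g : {linear W' -> W''})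
    (g' : {linear W -> W'}) (t : tensor V W) :
  tmap idfun (g \o g') t = tmap idfun g (tmap idfun g' t).
Proof. by rewrite tmap_comp; apply: eq_tmap. Qed.

Lemma tmapC (V V' W W' : lmodType k) (f : {linear V -> V'})
    (g : {linear W -> W'}) (t : tensor V W) :
  tmap idfun g (tmap f idfun t) = tmap f idfun (tmap idfun g t).
Proof. by rewrite !tmap_comp; apply: eq_tmap. Qed.

Lemma tassoc_tmapm (U V V' W : lmodType k) (g : {linear V -> V'})
    (t : tensor (tensor U V) W) :
  tassoc (tmap (tmap idfun g) idfun t) = tmap idfun (tmap g idfun) (tassoc t).
Proof. exact: tassoc_tmap. Qed.

Lemma tassoc_tmapr (U V W W' : lmodType k) (h : {linear W -> W'})
    (t : tensor (tensor U V) W) :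
  tassoc (tmap idfun h t) = tmap idfun (tmap idfun h) (tassoc t).
Proof.
rewrite -tassoc_tmap; congr tassoc.
by apply: eq_tmap => // x; rewrite tmap_id.
Qed.

(** Membership in A (x) W as an equation, to which coassociativity and the
    functoriality of the tensor product can be applied. *)
Lemma tens_subP (V W : lmodType k) (q : {linear V -> V}) (A : set V)
    (t : tensor V W) : (forall x, q x = 0 <-> A x) ->
  tens_sub A setT t <-> tmap q idfun t = 0.
Proof.
move=> qA; split=> [[s [sA ->]]|/tmap_ker[s [sA ->]]].
  rewrite linear_sum big_seq big1 // => p ps.
  by rewrite [LHS]tmapE (qA _).2 ?linear0l //; exact: (sA _ ps).1.
by exists s; split=> // p /sA [/qA ? ?].
Qed.

Lemma tens_sub_tmap (V W V' W' : lmodType k) (f : {linear V -> V'})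
    (g : {linear W -> W'}) (A : set V) (B : set W) (A' : set V') (B' : set W')
    (t : tensor V W) :
  (forall x, A x -> A' (f x)) -> (forall x, B x -> B' (g x)) ->
  tens_sub A B t -> tens_sub A' B' (tmap f g t).
Proof.
move=> fA gB [s [sAB ->]].
exists [seq (f p.1, g p.2) | p <- s]; split.
  by move=> _ /mapP [p /sAB [Ap Bp] ->]; split; [apply: fA|apply: gB].
by rewrite linear_sum big_map; apply: eq_bigr => p _; exact: tmapE.
Qed.

Lemma eq_tmap_sub (V W V' : lmodType k) (f g : {linear V -> V'}) (A : set V)
    (t : tensor V W) :
  (forall x, A x -> f x = g x) -> tens_sub A setT t ->
  tmap f idfun t = tmap g idfun t.
Proof.
move=> fg [s [sA ->]]; rewrite !linear_sum big_seq [RHS]big_seq.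
by apply: eq_bigr => p /sA[Ap _]; rewrite [LHS]tmapE [RHS]tmapE fg.
Qed.

End LinearAlgebra.

(** * Subcomodules, simple and semisimple comodules *)

Section ComoduleTheory.
Variables (k : fieldType) (C : coalgType k).
Implicit Types M N P : comod C.

Lemma comod_comp_subproof M N P (g : comodHom N P) (f : comodHom M N) m :
  coact P ((g \o f) m) = tmap (g \o f) idfun (coact M m).
Proof.
rewrite /= !comod_homP tmap_comp.
exact: eq_tmap.
Qed.

Definition comod_comp M N P (g : comodHom N P) (f : comodHom M N) :
  comodHom M P := ComodHom (comod_comp_subproof g f).

Lemma comod_id_subproof M m :
  coact M ((idfun : {linear M -> M}) m) = tmap idfun idfun (coact M m).
Proof. by rewrite tmap_id. Qed.

Definition comod_id M : comodHom M M := ComodHom (@comod_id_subproof M).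

Lemma subcomod_incl_subproof M (A : set M) (hA : subcomod A)
    (n : subcomodule hA) :
  coact M (subcomod_val hA n) = tmap (subcomod_val hA) idfun (coact _ n).
Proof. by rewrite -subcomod_coactE. Qed.

Definition subcomod_incl M (A : set M) (hA : subcomod A) :
  comodHom (subcomodule hA) M := ComodHom (@subcomod_incl_subproof M A hA).

Lemma subcomod_incl_inj M (A : set M) (hA : subcomod A) :
  injective (subcomod_incl hA).
Proof. exact: val_inj. Qed.

Lemma subcomod_inclP M (A : set M) (hA : subcomod A) x :
  A (subcomod_incl hA x).
Proof. exact: subcomod_valP. Qed.

Lemma subcomod_incl_surj M (A : set M) (hA : subcomod A) a :
  A a -> exists x, subcomod_incl hA x = a.
Proof. by move=> Aa; exists (subcomod_retr hA a); apply: subcomod_retr_val. Qed.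

Lemma corestrict M N (F : comodHom M N) (A : set N) (hA : subcomod A) :
  (forall m, A (F m)) -> exists G : comodHom M (subcomodule hA),
    forall m, subcomod_incl hA (G m) = F m.
Proof.
move=> AF.
have FE m : subcomod_incl hA (subcomod_retr hA (F m)) = F m.
  exact: subcomod_retr_val.
pose f := (subcomod_retr hA : {linear N -> subcomodule hA}) \o F.
suff fP m : coact _ (f m) = tmap f idfun (coact _ m).
  by exists (ComodHom fP).
apply: (@tmap_subcomod_inj _ _ _ _ hA); transitivity (coact N (F m)).
  by rewrite -[in RHS](FE m); symmetry; apply: subcomod_incl_subproof.
by rewrite tmap_comp comod_homP; apply: eq_tmap => // x; rewrite -[LHS]FE.
Qed.

Lemma subcomodT M : subcomod (@setT M).
Proof. 
split=> // m _; exists (repr (coact M m)); split=> //.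
exact: tensorE.
Qed.

Lemma subcomod0 M : subcomod [set (0 : M)].
Proof.
split=> [|_ ->].
  by split=> // a _ _ -> ->; rewrite /= scaler0 addr0.
by rewrite linear0; exists [::]; rewrite big_nil.
Qed.

Lemma subcomod_kerI M N (f : comodHom M N) : subcomod [set x | f x = 0].
Proof.
split; first exact: ker_subspace.
by move=> m /= fm; apply: tmap_ker; rewrite -comod_homP fm linear0.
Qed.

Lemma subcomod_image M N (f : comodHom M N) (A : set M) :
  subcomod A -> subcomod (f @` A).
Proof.
move=> [[A0 Al] Ac]; split=> [|_ [x Ax <-]].
  split=> [|a _ _ [x Ax <-] [y Ay <-]]; first by exists 0; rewrite ?linear0.
  by exists (a *: x + y); rewrite ?linearP //; apply: Al.
rewrite comod_homP; apply: (tens_sub_tmap (A := A) (B := setT)) (Ac _ Ax) => //.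
Qed.

(** Take a projection p onto A and q with kernel B. As p fixes A, the coaction of
    a point of the intersection is killed by q \o p on the left leg, and p maps
    the kernel of q \o p into the intersection. *)
Lemma subcomodI M (A B : set M) :
  subcomod A -> subcomod B -> subcomod (A `&` B).
Proof.
move=> [sA cA] [sB cB]; split=> [|m [Am Bm]].
  split=> [|a x y [Ax Bx] [Ay By]]; first by split; [apply: sA.1|apply: sB.1].
  by split; [apply: sA.2|apply: sB.2].
have [p [Ap pA]] := subspace_proj sA.
have [q qB] := subspace_ker sB.
have pE : coact M m = tmap p idfun (coact M m).
  rewrite (eq_tmap_sub (g := idfun) pA) ?tmap_id //; exact: cA.
have : tmap (q \o p) idfun (coact M m) = 0.
  rewrite -(tmap_comp q p idfun idfun) -pE.
  exact/(tens_subP _ qB)/cB.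
move/tmap_ker => h; rewrite pE.
by apply: tens_sub_tmap h => // x /qB Bpx; split.
Qed.

Lemma subcomodD M (A B : set M) : subcomod A -> subcomod B ->
  subcomod [set x | exists a b, [/\ A a, B b & x = a + b]].
Proof.
move=> [sA cA] [sB cB]; split.
  split=> [|c _ _ [a [b [Aa Bb ->]]] [a' [b' [Aa' Bb' ->]]]].
    by exists 0, 0; rewrite addr0; split=> //; [apply: sA.1|apply: sB.1].
  exists (c *: a + a'), (c *: b + b'); split; [exact: sA.2|exact: sB.2|].
  by rewrite scalerDr addrACA.
move=> _ [a [b [Aa Bb ->]]]; rewrite linearD.
have [s [sA' ->]] := cA _ Aa; have [t [tB ->]] := cB _ Bb.
exists (s ++ t); rewrite big_cat; split=> // p.
rewrite mem_cat => /orP[/sA'[Ap _]|/tB[Bp _]]; split=> //.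
  by exists p.1, 0; rewrite addr0; split=> //; apply: sB.1.
by exists 0, p.1; rewrite add0r; split=> //; apply: sA.1.
Qed.

Lemma bij_comod_inv M N (f : comodHom M N) : injective f ->
  (forall n, exists m, f m = n) ->
  exists g : comodHom N M, cancel f g /\ cancel g f.
Proof.
move=> f_inj f_surj.
pose g n := sval (cid (f_surj n)).
have gK : cancel g f by move=> n; exact: svalP (cid (f_surj n)).
have fK : cancel f g by move=> m; apply: f_inj; rewrite gK.
have lg : linear g by move=> a x y; apply: f_inj; rewrite linearP !gK.
suff gP n : coact M (lin_of lg n) = tmap (lin_of lg) idfun (coact N n).
  by exists (ComodHom gP).
rewrite -[n in RHS]gK comod_homP tmap_comp -[LHS]tmap_id.
by apply: eq_tmap => // x; rewrite /= fK.
Qed.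

Lemma simple_neq0 M : simple_comod M -> exists m : M, m != 0.
Proof.
move=> [_ M0 _]; apply: contrapT => nM; apply: M0; apply/seteqP; split=> // m _.
by apply: contrapT => /eqP m0; apply: nM; exists m.
Qed.

Lemma simple_subcomod_cases M (B : set M) : simple_comod M -> subcomod B ->
  B = [set 0] \/ B = setT.
Proof. by move=> [_ _ h] sB; apply: h. Qed.

Lemma subcomodule_simple M (A : set M) (hA : subcomod A) :
  simple_subcomod A -> simple_comod (subcomodule hA).
Proof.
move=> [_ A0 Amin]; split; first exact: subcomodT.
  move=> N0; apply: A0; apply/seteqP; split=> [a Aa|_ ->]; last exact: hA.1.1.
  have [x <-] := subcomod_incl_surj hA Aa.
  have -> : x = 0 by have : [set: subcomodule hA] x by []; rewrite N0.
  exact: linear0.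
move=> B sB _.
have [|BE|BE] := Amin _ (subcomod_image (subcomod_incl hA) sB).
- by move=> _ [x _ <-]; apply: subcomod_inclP.
- left; apply/seteqP; split=> [x Bx|_ ->]; last exact: sB.1.1.
  apply: (subcomod_incl_inj (hA := hA)); rewrite [RHS]linear0.
  have : (subcomod_incl hA @` B) (subcomod_incl hA x) by exists x.
  by rewrite BE.
right; apply/seteqP; split=> // x _.
have [y By /subcomod_incl_inj <- //] : (subcomod_incl hA @` B) (subcomod_incl hA x).
by rewrite BE; apply: subcomod_inclP.
Qed.

Lemma simple_hom_inj M N (f : comodHom M N) : simple_comod M ->
  (exists m, f m != 0) -> injective f.
Proof.
move=> sM [m fm].
have [fE|fE] := simple_subcomod_cases sM (subcomod_kerI f).
  move=> x y /eqP; rewrite -subr_eq0 -linearB => /eqP xy.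
  apply/subr0_eq; have : [set z | f z = 0] (x - y) by [].
  by rewrite fE.
have : [set z | f z = 0] m by rewrite fE.
by move=> /= e; rewrite e eqxx in fm.
Qed.

Lemma simple_hom_surj M N (f : comodHom M N) : simple_comod N ->
  (exists m, f m != 0) -> forall n, exists m, f m = n.
Proof.
move=> sN [m fm] n.
have [fE|fE] := simple_subcomod_cases sN (subcomod_image f (subcomodT M)).
  have : (f @` setT) (f m) by exists m.
  by rewrite fE => /= e; rewrite e eqxx in fm.
have : (f @` setT) n by rewrite fE.
by case=> x _ <-; exists x.
Qed.

Lemma schur M N (f : comodHom M N) : simple_comod M -> simple_comod N ->
  (exists m, f m != 0) -> exists g : comodHom N M, cancel f g /\ cancel g f.
Proof.
move=> sM sN f0; apply: bij_comod_inv; first exact: simple_hom_inj.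
exact: simple_hom_surj.
Qed.

Lemma semisimple_hom_neq0 M N (f : comodHom M N) (m : M) :
  semisimple_comod M -> f m != 0 ->
  exists (A : set M) (hA : subcomod A), simple_subcomod A /\
    exists x, f (subcomod_incl hA x) != 0.
Proof.
move=> ssM; have [s [-> sA]] := ssM m; rewrite linear_sum => fs.
have [x [xs fx]] : exists x, x \in s /\ f x != 0.
  apply: contrapT => nx; move/eqP: fs; apply; rewrite big_seq big1 // => x xs.
  by apply: contrapT => /eqP fx; apply: nx; exists x.
have [A [Asimp Ax]] := sA _ xs.
have [hA _ _] := Asimp; exists A, hA; split=> //.
by have [y ye] := subcomod_incl_surj hA Ax; exists y; rewrite ye.
Qed.

(** Some simple subcomodule is not killed by f, hence is mapped isomorphically
    onto N by Schur's lemma. *)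
Lemma simple_quotient_splits M N (f : comodHom M N) : semisimple_comod M ->
  simple_comod N -> (exists m, f m != 0) ->
  exists i : comodHom N M, cancel i f.
Proof.
move=> ssM sN [m fm].
have [A [hA [Asimp x0]]] := semisimple_hom_neq0 ssM fm.
have [g [_ gK]] := @schur _ _ (comod_comp f (subcomod_incl hA))
  (subcomodule_simple hA Asimp) sN x0.
by exists (comod_comp (subcomod_incl hA) g) => n; apply: gK.
Qed.

(** Zorn's lemma gives a subcomodule B that is maximal among those meeting A
    trivially. A simple subcomodule S not contained in A + B would meet it
    trivially, and then B + S would contradict maximality. *)
Lemma subcomod_complement M (A : set M) : semisimple_comod M -> subcomod A ->
  exists B : set M, [/\ subcomod B, A `&` B `<=` [set 0] &
    forall x, exists a b, [/\ A a, B b & x = a + b]].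
Proof.
move=> ssM cA.
pose P (B : set M) := [/\ forall a x y, B x -> B y -> B (a *: x + y),
  forall m, B m -> tens_sub B setT (coact M m) & A `&` B `<=` [set 0]].
have [|B [[Bl Bc AB] Bmax]] := @Zorn_bigcup M P.
  move=> F FP Ftot; rewrite /P.
  split=> [a x y [X FX Xx] [Y FY Yy]|m [X FX Xm]|x [Ax [X FX Xx]]].
  - have [XY|YX] := Ftot _ _ FX FY.
      by exists Y => //; have [Yl _ _] := FP _ FY; apply: Yl => //; apply: XY.
    by exists X => //; have [Xl _ _] := FP _ FX; apply: Xl => //; apply: YX.
  - have [_ /(_ _ Xm)[s [sX e]] _] := FP _ FX.
    by exists s; split=> // p /sX[Xp _]; split=> //; exists X.
  by have [_ _ h] := FP _ FX; apply: h.
(* The union of the empty chain is empty, so 0 is not required to lie in B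
   beforehand; maximality provides it. *)
have B0 : B 0.
  have [[b Bb]|nB] := pselect (exists b, B b).
    by rewrite -(addNr b) -scaleN1r; apply: Bl.
  have nB' b : ~ B b by move=> Bb; apply: nB; exists b.
  exfalso; apply: (Bmax [set 0]).
    by split=> [b /nB'//|]; move=> /(_ 0 erefl) /nB'.
  have [[_ h1] h2] := subcomod0 M; split=> //.
have cB : subcomod B by [].
exists B; split=> // x.
(* It remains to see that A + B is everything. *)
pose AB' : set M := [set x | exists a b, [/\ A a, B b & x = a + b]].
have cAB : subcomod AB' by apply: subcomodD.
rewrite -/(AB' x); have [s [-> sS]] := ssM x.
apply: (subspace_sum (A := AB') (F := idfun)) => [|y ys]; first exact: cAB.1.
apply: contrapT => nABy.
have [S [[cS S0 Smin] Sy]] := sS _ ys.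
have SAB : S `&` AB' = [set 0].
  have [||//|e] := Smin (S `&` AB'); [exact: subcomodI|by move=> z []|].
  have : (S `&` AB') y by rewrite e.
  by case.
have sub0 z : S z -> AB' z -> z = 0.
  by move=> Sz ABz; have : (S `&` AB') z by []; rewrite SAB.
have cBS := subcomodD cB cS.
have BA b : B b -> AB' b.
  by move=> Bb; exists 0, b; rewrite add0r; split=> //; exact: cA.1.1.
apply: (Bmax [set x | exists a b, [/\ B a, S b & x = a + b]]); last first.
  have [[_ h1] h2] := cBS; split=> // z [Az [b [t [Bb St zE]]]].
  have t0 : t = 0.
    apply: sub0 => //; have -> : t = z - b by rewrite zE addrC addKr.
    apply: subspaceB; [exact: cAB.1| |exact: BA].
    by exists z, 0; rewrite addr0.
  by apply: AB; split=> //; rewrite zE t0 addr0.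
split=> [b Bb|sub]; first by exists b, 0; rewrite addr0; split=> //; exact: cS.1.1.
apply: nABy; apply: BA; apply: sub.
by exists 0, y; rewrite add0r.
Qed.

(** The projection along a complementary subcomodule is a comodule morphism,
    because it is so on each of the two summands. *)
Lemma subcomod_retract M (A : set M) (hA : subcomod A) : semisimple_comod M ->
  exists r : comodHom M (subcomodule hA), cancel (subcomod_incl hA) r.
Proof.
move=> ssM; have [B [cB AB ABT]] := subcomod_complement ssM hA.
have ex x : exists y : subcomodule hA, B (x - subcomod_incl hA y).
  have [a [b [Aa Bb ->]]] := ABT x.
  have [y ye] := subcomod_incl_surj hA Aa.
  by exists y; rewrite ye addrC addKr.
pose r x := sval (cid (ex x)).
have rP x : B (x - subcomod_incl hA (r x)) := svalP (cid (ex x)).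
have ru x y : B (x - subcomod_incl hA y) -> r x = y.
  move=> Bxy; apply: (subcomod_incl_inj (hA := hA)); apply/subr0_eq.
  apply: AB; split; first by rewrite -linearB; apply: subcomod_inclP.
  have := subspaceB cB.1 Bxy (rP x); congr B.
  by rewrite opprB addrC addrA subrK.
have lr : linear r.
  move=> a x y; apply: ru.
  have -> : a *: x + y - subcomod_incl hA (a *: r x + r y) =
      a *: (x - subcomod_incl hA (r x)) + (y - subcomod_incl hA (r y)).
    by rewrite linearP scalerBr addrACA opprD.
  exact: cB.1.2.
have rK : cancel (subcomod_incl hA) r.
  by move=> y; apply: ru; rewrite subrr; apply: cB.1.1.
have rB b : B b -> r b = 0.
  by move=> Bb; apply: ru; rewrite [subcomod_incl hA 0]linear0 subr0.
suff lrP m : coact _ (lin_of lr m) = tmap (lin_of lr) idfun (coact M m).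
  by exists (ComodHom lrP).
have [a [b [Aa Bb ->]]] := ABT m.
have [y <-] := subcomod_incl_surj hA Aa.
have b0 : tmap (lin_of lr) idfun (coact M b) = 0.
  rewrite (eq_tmap_sub (g := \0) (A := B)) //; last exact: cB.2.
  exact: tmap0.
rewrite [lin_of lr _]linearD [lin_of lr b]rB // addr0.
rewrite [coact M _]linearD tmapD b0 addr0.
rewrite -[lin_of lr _]/(r _) rK comod_homP tmap_comp -[LHS]tmap_id.
by apply: eq_tmap => // x; rewrite /= rK.
Qed.

Lemma simple_sub_splits M N (i : comodHom N M) : semisimple_comod M ->
  simple_comod N -> (exists n, i n != 0) ->
  exists r : comodHom M N, cancel i r.
Proof.
move=> ssM sN [n in0].
have hA : subcomod (i @` setT) by apply/subcomod_image/subcomodT.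
have [r rK] := subcomod_retract hA ssM.
have rE x : subcomod_incl hA (r (i x)) = i x.
  have [|y ye] := @subcomod_incl_surj _ _ hA (i x); first by exists x.
  by rewrite -ye rK.
have [||g [gK _]] := @bij_comod_inv _ _ (comod_comp r i).
- move=> x y /= e; apply: (simple_hom_inj sN (ex_intro _ n in0)).
  by rewrite -(rE x) -(rE y); congr (subcomod_incl hA _).
- move=> y; have [x _ xe] := subcomod_inclP y.
  by exists x; apply: (subcomod_incl_inj (hA := hA)); rewrite -xe; apply: rE.
by exists (comod_comp g r) => x; apply: gK.
Qed.

Lemma simple_summandP M (W : comod C) : semisimple_comod M -> simple_comod W ->
  comod_summand W M <-> hom_neq0 M W.
Proof.
move=> ssM sW; split=> [[i [p ip]]|[f [m fm]]].
  have [w w0] := simple_neq0 sW.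
  by exists p, (i w); rewrite ip.
have [|i iK] := simple_quotient_splits ssM sW (f := f); first by exists m.
by exists i, f.
Qed.

Definition regular : comod C := Comod (@comulA k C) (@counitr k C).

Lemma comod_iso_sym M N : comod_iso M N -> comod_iso N M.
Proof. by case=> f [g [fK gK]]; exists g, f. Qed.

Lemma comod_iso_trans M N P : comod_iso M N -> comod_iso N P -> comod_iso M P.
Proof.
case=> f [g [fK gK]] [f' [g' [fK' gK']]].
by exists (comod_comp f' f), (comod_comp g g'); split=> x /=;
  rewrite ?fK' ?fK ?gK ?gK'.
Qed.

Lemma hom_neq0_iso M M' N N' : comod_iso M M' -> comod_iso N N' ->
  hom_neq0 M N -> hom_neq0 M' N'.
Proof.
case=> f [f' [fK _]] [g [g' [gK _]]] [h [m hm]].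
exists (comod_comp g (comod_comp h f')), (f m) => /=; rewrite fK.
by apply: contraNneq hm => e; rewrite -(gK (h m)) e linear0.
Qed.

Definition irrep_of (S : simpleComod C) : irrep C :=
  exist _ (fun V' : simpleComod C => comod_iso S V') (ex_intro _ S erefl).

Lemma irrep_svalE (W : irrep C) : sval W = (fun V' => comod_iso W V').
Proof. exact: svalP (cid (svalP W)). Qed.

Lemma comod_iso_refl M : comod_iso M M.
Proof. by exists (comod_id M), (comod_id M). Qed.

Lemma irrep_ofK (S : simpleComod C) : comod_iso S (irrep_of S).
Proof.
have : sval (irrep_of S) (irrep_of S).
  by rewrite irrep_svalE; apply: comod_iso_refl.
by [].
Qed.

Lemma irrep_eq (W W' : irrep C) : comod_iso W W' -> W = W'.
Proof.
move=> e; have : sval W = sval W'.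
  rewrite !irrep_svalE; apply/funext => V.
  apply/propext; split; last exact: comod_iso_trans.
  exact/comod_iso_trans/comod_iso_sym.
case: W W' {e} => [A hA] [B hB] /= eAB; case: B / eAB hB => hB.
by congr exist; apply: Prop_irrelevance.
Qed.

End ComoduleTheory.

(** * Frobenius reciprocity *)

Section Frobenius.
Variables (k : fieldType) (OG OH : hopfAlgType k) (pi : hopfMor OG OH).
Variables (V : comod OG) (W : comod OH).

Let eW := tlift_lin (counit_bilinear OG W).

(** Applying the counit to the last leg does not depend on the bracketing. *)
Lemma counit_tassoc (U X : lmodType k) (t : tensor (tensor U X) OG) :
  tlift (fun u c => counit c *: u) t =
  tmap idfun (tlift_lin (counit_bilinear OG X)) (tassoc t).
Proof.
apply: (@tensor_ext3 _ _ _ _ _ (tlift_lin (counit_bilinear OG (tensor U X)))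
  (tmap idfun (tlift_lin (counit_bilinear OG X)) \o @tassoc _ _ _ _)) => u x c.
rewrite -[LHS]/(tlift _ _) (tliftE (counit_bilinear _ _)).
rewrite -[RHS]/(tmap _ _ (tassoc _)) tassocE tmapE.
by rewrite -[X in _ = _ \ox X]/(tlift _ _) (tliftE (counit_bilinear _ _)) linearZr_LR.
Qed.

Lemma cofree_counit (z : tensor W OG) :
  tmap eW idfun (cofree_coact OG W z) = z.
Proof.
apply: (@tensor_ext _ _ _ _ (tmap eW idfun \o cofree_coact OG W) idfun) => w c.
rewrite -[LHS]/(tmap _ _ (cofree_coact _ _ _)) cofree_coactE tmap_comp.
rewrite -[c in RHS]counitl.
rewrite [in LHS](tensorE (comul c)) [in RHS]tlift.unlock.
rewrite linear_sum [RHS]linear_sum; apply: eq_bigr => p _.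
rewrite [LHS]tmapE -[X in X \ox _]/(tlift _ _) (tliftE (counit_bilinear _ _)).
by rewrite linearZl_LR [RHS]linearZr_LR.
Qed.

(** Applying the counit to the last leg of the equation that defines the
    cotensor product. *)
Lemma cotensor_coact (z : tensor W OG) : cotensor pi z ->
  coact W (eW z) = tmap idfun pi z.
Proof.
move=> hz; rewrite counit_tmap counit_tassoc hz tmap_comp.
apply: eq_tmap => // x.
by rewrite -[LHS]/(tlift _ (tmap _ _ _)) -counit_tmap counitr.
Qed.

(** The morphism corresponding to f is v |-> f(v_0) (x) v_1; applying the
    counit to its last leg gives f back, so it is nonzero when f is. *)
Lemma frobenius_fwd : hom_neq0 (Res pi V) W -> hom_neq0 V (Ind pi W).
Proof.
move=> [f [v fv]].
pose F : {linear V -> cofree OG W} := tmap f idfun \o coact V.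
have FP m : coact _ (F m) = tmap F idfun (coact V m).
  rewrite -[LHS]/(tassocV (tmap idfun comul (tmap f idfun (coact V m)))).
  rewrite tmap_comp (eq_tmap (f' := f \o idfun) (g' := tmap idfun idfun \o comul)) //;
    last by move=> x; rewrite /= tmap_id.
  rewrite -(tmap_comp f idfun (tmap idfun idfun) comul) tassocV_tmap.
  by rewrite -[tmap idfun comul _](coactA m) tassocK tmap_comp.
have FC m : cotensor pi (F m).
  change (tassoc (tmap (coact W) idfun (tmap f idfun (coact V m))) =
    tmap idfun (left_coact pi) (tmap f idfun (coact V m))).
  rewrite !tmap_comp.
  rewrite (eq_tmap (f' := tmap f pi \o coact V) (g' := idfun \o idfun)) //;
    last first.
    move=> x; transitivity (tmap f idfun (coact (Res pi V) x)).
      exact: comod_homP.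
    exact: tmap_comp.
  rewrite -(tmap_comp _ (coact V) idfun idfun) tassoc_tmap coactA tmap_comp.
  exact: eq_tmap.
have [G GF] := corestrict (F := ComodHom FP) (cotensor_subcomod pi W) FC.
exists G, v; apply: contraNneq fv => Gv.
have F0 : F v = 0 by rewrite -[F v]GF Gv [LHS]linear0.
apply/eqP; rewrite -(coact_counit (v : V)) [LHS](counit_tmap f (coact V v)).
by rewrite -[tmap f _ _]/(F v) F0 -[LHS]/(eW 0) linear0.
Qed.

(** Conversely, apply the counit to the last leg of the values of g. The result
    f satisfies f(v_0) (x) v_1 = g(v), so it vanishes only if g does. *)
Lemma frobenius_bwd : hom_neq0 V (Ind pi W) -> hom_neq0 (Res pi V) W.
Proof.
move=> [g [v gv]].
pose h := comod_comp (subcomod_incl (cotensor_subcomod pi W)) g.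
have hC m : cotensor pi (h m) by apply: subcomod_inclP.
pose f : {linear Res pi V -> W} := eW \o h.
have fh m : tmap f idfun (coact V m) = h m.
  by rewrite -[RHS]cofree_counit -[cofree_coact _ _ _]/(coact (cofree OG W) (h m))
    comod_homP tmap_comp.
suff fP m : coact W (f m) = tmap f idfun (coact (Res pi V) m).
  exists (ComodHom fP); apply: contrapT => nf.
  have f0 m : f m = 0 by apply: contrapT => /eqP fm; apply: nf; exists m.
  move/eqP: gv; apply; apply: (@subcomod_incl_inj _ _ _ _ (cotensor_subcomod pi W)).
  rewrite -[LHS]/(h v) -fh [RHS]linear0.
  by rewrite (eq_tmap (f' := \0) (g' := idfun)) // tmap0.
rewrite -[f m]/(eW (h m)) cotensor_coact // -fh !tmap_comp.
exact: eq_tmap.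
Qed.

End Frobenius.

(** * Matrix coefficients *)

Section Coefficients.
Variables (k : fieldType) (C : coalgType k).
Implicit Types M W : comod C.

(** The matrix coefficient m |-> phi(m_0) m_1. *)
Definition coef M (phi : {linear M -> k^o}) : {linear M -> C} :=
  lslice C phi \o coact M.

Lemma coef_subproof M phi m :
  coact (regular C) (@coef M phi m) = tmap (coef phi) idfun (coact M m).
Proof.
rewrite -[LHS]/(comul (lslice C phi (coact M m))).
have := lslice_tmap idfun comul phi (coact M m).
rewrite -coactA lslice_tassoc tmap_comp => /esym.
rewrite -[phi \o _]/(phi : _ -> _) => e.
rewrite -[LHS]/(comul (lslice C (phi \o idfun) (coact M m))).
by rewrite e.
Qed.

Definition coef_hom M phi : comodHom M (regular C) :=
  ComodHom (@coef_subproof M phi).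

Lemma counit_coef M phi m : counit (@coef M phi m) = phi m.
Proof.
rewrite -[in RHS](coact_counit m) -[coef _ _]/(lslice C phi _) (tensorE (coact M m)).
rewrite -[X in _ = phi X]/(tlift_lin (counit_bilinear C M) _) !linear_sum.
apply: eq_bigr => p _; rewrite lsliceE.
rewrite -[X in _ = phi X]/(tlift _ _) (tliftE (counit_bilinear C M)) !linearZ.
exact: mulrC.
Qed.

(** Spanned by the matrix coefficients of M: the least subspace E of C such
    that the coaction of M takes values in M (x) E. *)
Definition coef_space M : set C := [set c | forall B : set C, subspace B ->
  (forall phi m, B (@coef M phi m)) -> B c].

Lemma coef_space_subspace M : subspace (coef_space M).
Proof.
split=> [B sB _|a x y cx cy B sB cB]; first exact: sB.1.
by apply: sB.2; [apply: cx|apply: cy].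
Qed.

Lemma coact_coef_space M (q : {linear C -> C}) :
  (forall c, q c = 0 <-> coef_space M c) ->
  forall m, tmap idfun q (coact M m) = 0.
Proof.
move=> qM m; apply: lslice_eq0 => phi; rewrite lslice_tmap; apply/qM => B _ cB.
exact: (cB phi).
Qed.

(** If the coefficients of a simple W lie among those of M, then W is a quotient
    of M. Embed W into C by a coefficient map and retract C onto W, using
    cosemisimplicity. If there were no nonzero morphism from M to W, the
    retraction would kill every coefficient of M, hence the image of W. *)
Lemma coef_space_hom M W (q : {linear C -> C}) : cosemisimple C ->
  simple_comod W -> (forall c, q c = 0 <-> coef_space M c) ->
  (forall w, tmap idfun q (coact W w) = 0) -> hom_neq0 M W.
Proof.
move=> ssC sW qM qW; apply: contrapT => nh.
have [w w0] := simple_neq0 sW.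
have [psi psiw] := functional_neq0 w0.
have cw : coef psi w != 0.
  by apply: contraNneq psiw; rewrite -counit_coef => ->; rewrite linear0.
have [|r rK] := @simple_sub_splits _ _ (regular C) W (coef_hom psi) (ssC _) sW.
  by exists w.
have r0 : r (coef psi w) = 0.
  have /qM cM : q (coef psi w) = 0.
    by have := lslice_tmap idfun q psi (coact W w); rewrite qW linear0 => /esym.
  apply: (cM [set z | r z = 0]); first exact: ker_subspace.
  move=> phi m /=; apply: contrapT => /eqP rm; apply: nh.
  by exists (comod_comp r (coef_hom phi)), m.
by move: w0; rewrite -(rK w) -[coef_hom psi w]/(coef psi w) r0 eqxx.
Qed.

End Coefficients.

(** * The adjoint coaction *)

Section Adjoint.
Variables (k : fieldType) (A : hopfAlgType k).

Lemma lmul_linear (a : A) : linear (fun x : A => a * x).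
Proof. by move=> c x y; rewrite mulrDr scalerAr. Qed.

Definition lmul (a : A) : {linear A -> A} := lin_of (lmul_linear a).

Section Twist.
Variables (X Y : lmodType k) (h : {linear Y -> tensor X A}).

Lemma twist_bilinear : bilinear_for *:%R *:%R
  (fun (a : A) (y : Y) => tmap (idfun : {linear X -> X}) (lmul a) (h y)).
Proof.
split=> [y c a b|a c y z]; last by rewrite [h _]linearP; exact: linearP.
rewrite /= /tmap tlift.unlock /tens_sum scaler_sumr -big_split.
by apply: eq_bigr => p _ /=; rewrite mulrDl -scalerAl linearPr.
Qed.

(** Left multiplication by a on the last leg of h(y): it serves to cancel the
    factor S(x_1) of the adjoint coaction. *)
Definition twist : {linear tensor A Y -> tensor X A} := tlift_lin twist_bilinear.

Lemma twistE a y : twist (a \ox y) = tmap idfun (lmul a) (h y).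
Proof. exact: (tliftE twist_bilinear). Qed.

End Twist.

Lemma twist_comp (X Y Z : lmodType k) (h : {linear Y -> tensor X A})
    (u : {linear Z -> Y}) t : twist (h \o u) t = twist h (tmap idfun u t).
Proof.
apply: (@tensor_ext _ _ _ _ (twist (h \o u)) (twist h \o tmap idfun u)) => a z.
by rewrite -[RHS]/(twist h (tmap _ _ _)) tmapE !twistE.
Qed.

Lemma twist_tmap (X X' Y : lmodType k) (h : {linear Y -> tensor X A})
    (f : {linear X -> X'}) t :
  twist (tmap f idfun \o h) t = tmap f idfun (twist h t).
Proof.
apply: (@tensor_ext _ _ _ _ (twist (tmap f idfun \o h))
  (tmap f idfun \o twist h)) => a z.
rewrite -[RHS]/(tmap _ _ (twist _ _)) !twistE.
transitivity (tmap (idfun \o f) (lmul a \o idfun) (h z)); last first.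
  by rewrite [RHS]tmap_comp; apply: eq_tmap.
exact: tmap_comp.
Qed.

Section AdFold.
Variable Y : lmodType k.

Lemma ad_fold_in_bilinear (c : A) : bilinear_for *:%R *:%R
  (fun (a : A) (y : Y) => y \ox (antipode a * c)).
Proof.
split=> [y e a b|a e y z] /=; last by rewrite linearPl.
by rewrite linearP mulrDl -scalerAl linearPr.
Qed.

Lemma ad_fold_bilinear : bilinear_for *:%R *:%R
  (fun (t : tensor A Y) (c : A) => tlift (fun a y => y \ox (antipode a * c)) t).
Proof.
split=> [c|t e c d] /=; first exact: (tlift_linear (ad_fold_in_bilinear c)).
rewrite tlift.unlock /tens_sum /= scaler_sumr -big_split.
by apply: eq_bigr => p _ /=; rewrite mulrDr -scalerAr linearPr.
Qed.

(** The map (a (x) y) (x) c |-> y (x) S(a) c, so that [ad_r] is [ad_fold]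
    applied to the iterated comultiplication. *)
Definition ad_fold : {linear tensor (tensor A Y) A -> tensor Y A} :=
  tlift_lin ad_fold_bilinear.

Lemma ad_foldE a y c : ad_fold (a \ox y \ox c) = y \ox (antipode a * c).
Proof.
by rewrite [LHS](tliftE ad_fold_bilinear) (tliftE (ad_fold_in_bilinear c)).
Qed.

End AdFold.

Lemma ad_fold_tmap (Y Z : lmodType k) (f : {linear Y -> Z}) t :
  tmap f idfun (ad_fold Y t) = ad_fold Z (tmap (tmap idfun f) idfun t).
Proof.
apply: (@tensor_ext3 _ _ _ _ _ (tmap f idfun \o ad_fold Y)
  (ad_fold Z \o tmap (tmap idfun f) idfun)) => a y c.
rewrite -[LHS]/(tmap _ _ (ad_fold _ _)) -[RHS]/(ad_fold _ (tmap _ _ _)) ad_foldE !tmapE.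
by rewrite -[X in ad_fold _ (X \ox _)]/(tmap _ _ _) tmapE ad_foldE.
Qed.

Definition ad_r_lin : {linear A -> tensor A A} :=
  ad_fold A \o (tmap comul idfun \o comul).

(** In Sweedler notation the left side is x_3 (x) x_1 S(x_2) x_4, where
    x_1 S(x_2) collapses to a counit and leaves x_1 (x) x_2. Thus the
    comultiplication can be recovered from the adjoint coaction. *)
Lemma twist_ad_r x : twist ad_r_lin (comul x) = comul x.
Proof.
rewrite twist_comp tmap_compr -comulA -tassoc_tmapm -tmap_compl.
rewrite (eq_tmap (f' := (@tassoc _ _ _ _ \o tmap comul idfun) \o comul)
  (g' := idfun)) //; last by move=> y; rewrite /= -comulA.
rewrite tmap_compl.
pose cl := tlift_lin (lslice_bilinear A (counit : {linear A -> k^o})).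
(* For u = (y (x) b) (x) c this is the antipode axiom for y. *)
have key u : twist (ad_fold A) (tassoc (tmap (@tassoc _ _ _ _ \o tmap comul idfun)
    idfun u)) = tmap cl idfun u.
  apply: (@tensor_ext3 _ _ _ _ _ (twist (ad_fold A) \o (@tassoc _ _ _ _ \o
    tmap (@tassoc _ _ _ _ \o tmap comul idfun) idfun)) (tmap cl idfun)).
  move=> y b c; rewrite -[LHS]/(twist _ (tassoc (tmap _ _ _))) tmapE [RHS]tmapE.
  rewrite -[X in tassoc (X \ox _)]/(tassoc (tmap _ _ _)) tmapE.
  rewrite -[X in _ = X \ox _]/(lslice A _ _) lsliceE linearZl_LR -linearZr_LR.
  have -> : counit y *: c = (counit y)%:A * c by rewrite -scalerAl mul1r.
  rewrite -antipoder tlift.unlock /tens_sum [in LHS](tensorE (comul y)).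
  rewrite mulr_suml linear_sumr linear_sumlz !linear_sum linear_sumlz !linear_sum.
  apply: eq_bigr => p _.
  rewrite -[LHS]/(twist _ (tassoc (tassoc (p.1 \ox p.2 \ox b) \ox c))).
  by rewrite !tassocE twistE ad_foldE tmapE /= mulrA.
rewrite key -tmap_compl -[RHS]tmap_id.
by apply: eq_tmap => // y; exact: counitl.
Qed.

End Adjoint.

(** * Normality and coefficients *)

Section Normal.
Variables (k : fieldType) (A B : hopfAlgType k) (pi : hopfMor A B).
Hypothesis pi_normal : normal_embedding pi.

Section Stable.
Variables (V : comod A) (q : {linear B -> B}).
Hypothesis qV : forall c, q c = 0 <-> coef_space (Res pi V) c.

Let G : {linear A -> tensor B A} := tmap (q \o pi) idfun \o ad_r_lin A.

(** The coefficients of V are stable under the adjoint coaction: for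
    x = phi(v_0) v_1 the middle leg of x_1 (x) x_2 (x) x_3 is again a
    coefficient of V, so that q o pi kills it. *)
Lemma ad_r_coact v : tmap idfun G (coact V v) = 0.
Proof.
pose qp : {linear A -> B} := q \o pi.
have qc m : tmap idfun qp (coact V m) = 0.
  rewrite -[RHS](coact_coef_space qV m).
  by rewrite -[coact (Res pi V) m]/(tmap _ _ (coact V m)) tmap_comp; apply: eq_tmap.
pose H : {linear A -> tensor (tensor A B) A} :=
  tmap (tmap idfun qp) idfun \o (tmap comul idfun \o comul).
rewrite (eq_tmap (f' := idfun) (g' := ad_fold A B \o H)) //; last first.
  by move=> x; rewrite -[LHS]/(tmap _ _ (ad_fold _ _ _)) ad_fold_tmap.
rewrite tmap_compr -[RHS](linear0 (tmap idfun (ad_fold A B))); congr (tmap _ _ _).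
rewrite !tmap_compr -coactA -!tassoc_tmapm -!tmap_compl.
rewrite (eq_tmap (f' := \0) (g' := idfun)) ?tmap0 ?linear0 // => m.
rewrite -[LHS]/(tmap _ _ (tmap _ _ (coact V m))) -coactA -tassoc_tmapr tmapC qc.
by rewrite !linear0.
Qed.

(** The adjoint coaction followed by q o pi on the first leg kills ker pi by
    normality and kills the coefficients of V by [ad_r_coact], hence it kills
    the kernel of q o pi. *)
Lemma ad_r_factor : exists h : {linear B -> tensor B A},
  forall x, h (q (pi x)) = tmap (q \o pi) idfun (ad_r x).
Proof.
have [|h hE] := @lin_factor _ _ _ _ (q \o pi : {linear A -> B}) G; last first.
  by exists h => x; rewrite [LHS]hE.
move=> x /= /qV.
have GK y : pi y = 0 -> G y = 0.
  move=> /pi_normal[_ [s [sK e]]].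
  rewrite -[G y]/(tmap _ _ (ad_r y)) e linear_sum big_seq big1 // => p /sK[pK _].
  by rewrite [LHS]tmapE /= pK linear0 linear0l.
have sI : subspace [set c | exists y, pi y = c /\ G y = 0].
  split=> [|a _ _ [y [<- Gy]] [z [<- Gz]]]; first by exists 0; rewrite !linear0.
  by exists (a *: y + z); rewrite !linearP Gy Gz scaler0 addr0.
move=> /(_ _ sI)[phi m|y [piy Gy]].
  exists (lslice A phi (coact V m)); split.
    by rewrite -[RHS]/(lslice _ _ (tmap idfun pi (coact V m))) lslice_tmap.
  have := lslice_tmap idfun G phi (coact V m).
  by rewrite ad_r_coact linear0 => /esym.
have e : G (x - y) = 0.
  by apply: GK; rewrite [LHS]rmorphB; apply/eqP; rewrite subr_eq0; apply/eqP/esym.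
by rewrite -[LHS]/(G x) -(subrK y x) linearD e Gy addr0.
Qed.

End Stable.

(** The vectors of V whose coefficients over B are coefficients of V' form a
    subcomodule over A. This is where normality enters: by [twist_ad_r] and
    [ad_r_factor], q(pi(x_1)) (x) x_2 is a linear function of
    x_1 (x) q(pi(x_2)). Hence v_0 (x) q(pi(v_1)) (x) v_2 is a linear function of
    v_0 (x) v_1 (x) q(pi(v_2)), which vanishes as soon as v_0 (x) q(pi(v_1))
    does. *)
Lemma isotypic_subcomod (V V' : comod A) (q : {linear B -> B}) :
  (forall c, q c = 0 <-> coef_space (Res pi V') c) ->
  subcomod [set v : V | tmap idfun (q \o pi) (coact V v) = 0].
Proof.
move=> qV; have [h hE] := ad_r_factor qV.
pose qp : {linear A -> B} := q \o pi.
have key x : tmap qp idfun (comul x) = twist h (tmap idfun qp (comul x)).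
  rewrite -[in LHS]twist_ad_r -twist_tmap -twist_comp.
  rewrite /twist /=; apply: eq_tlift => a y.
  by congr tmap; rewrite /= hE.
pose F : {linear V -> tensor V B} := tmap idfun qp \o coact V.
split=> [|v /= Fv]; first exact: (ker_subspace F).
apply: (tmap_ker (f := F)); apply: (can_inj (@tassocK _ _ _ _)).
rewrite linear0 tmap_compl tassoc_tmapm coactA -tmap_compr.
rewrite (eq_tmap (f' := idfun) (g' := twist h \o (tmap idfun qp \o comul))) //.
by rewrite !tmap_compr -coactA -tassoc_tmapr tmapC Fv !linear0.
Qed.

End Normal.

(** * Finiteness of simple comodules *)

Section Finiteness.
Variables (k : fieldType) (C : coalgType k).

(** The right-hand sides are the vectors of the cyclic module generated by m
    over the dual algebra of C, and this module is a subcomodule. In particular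
    a simple comodule is finite-dimensional, since the slices of one fixed
    finite sum of pure tensors lie in the span of its left factors. *)
Lemma simple_comod_span (M : comod C) (m : M) : simple_comod M -> m != 0 ->
  forall x, exists eta : {linear C -> k^o}, x = rslice M eta (coact M m).
Proof.
move=> sM m0 x.
pose X : set M := [set x | exists eta : {linear C -> k^o},
  x = rslice M eta (coact M m)].
have rsliceP (eta : {linear C -> k^o}) t :
    rslice M eta t = \sum_(p <- repr t) eta p.2 *: p.1.
  by rewrite [in LHS](tensorE t) linear_sum; apply: eq_bigr => p _; rewrite rsliceE.
have sX : subspace X.
  split=> [|a _ _ [eta ->] [xi ->]].
    exists \0; rewrite rsliceP big1 // => p _; exact: scale0r.
  exists (a \*: eta \+ xi); rewrite !rsliceP scaler_sumr -big_split.
  by apply: eq_bigr => p _ /=; rewrite scalerDl scalerA.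
have [q qX] := subspace_ker sX.
have cX : subcomod X.
  split=> // _ [eta ->]; apply/(tens_subP _ qX)/rslice_eq0 => xi.
  rewrite rslice_tmap; apply/qX.
  (* The convolution product of xi and eta. *)
  exists ((eta \o lslice C xi) \o comul).
  rewrite -[RHS](rslice_tmap idfun comul) -coactA -rslice_tassoc.
  by rewrite rslice_tmap.
have Xm : X m.
  exists (counit : {linear C -> k^o}).
  by rewrite -[LHS]coact_counit.
have [XE|XE] := simple_subcomod_cases sM cX; last first.
  by have : [set: M] x by []; rewrite -XE.
by move: Xm m0; rewrite XE => ->; rewrite eqxx.
Qed.

(** By Schur's lemma A can only map nontrivially to its own isomorphism class. *)
Lemma simple_element_irrep (M : comod C) (A : set M) (x : M) :
  simple_subcomod A -> A x ->
  exists T : irrep C, forall (W : irrep C) (f : comodHom M W),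
    f x != 0 -> W = T.
Proof.
move=> sA Ax; have [hA _ _] := sA.
exists (irrep_of (SimpleComod (subcomodule_simple hA sA))) => W f fx.
have [y ye] := subcomod_incl_surj hA Ax.
have [|g [fK gK]] := schur (f := comod_comp f (subcomod_incl hA))
  (subcomodule_simple hA sA) (simpleP W).
  by exists y; rewrite -ye in fx.
apply: irrep_eq; apply: comod_iso_trans (irrep_ofK _).
by exists g, (comod_comp f (subcomod_incl hA)).
Qed.

(** Finitely many vectors lie in a finite sum of simple subcomodules. It is
    enough to know that linear maps vanishing on the list s vanish on l. *)
Lemma semisimple_span (M : comod C) (l : seq M) : semisimple_comod M ->
  exists s : seq M,
    (forall x, x \in s -> exists A : set M, simple_subcomod A /\ A x) /\
    forall (W : lmodType k) (f : {linear M -> W}),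
      (forall x, x \in s -> f x = 0) -> forall m, m \in l -> f m = 0.
Proof.
move=> ssM; elim: l => [|m l [s [sA sl]]]; first by exists [::].
have [t [mE tA]] := ssM m.
exists (t ++ s); split=> [x|W f f0 x].
  by rewrite mem_cat => /orP[/tA|/sA].
rewrite inE => /orP[/eqP ->|]; last first.
  by apply: sl => y ys; apply: f0; rewrite mem_cat ys orbT.
rewrite mE linear_sum big_seq big1 // => y yt.
by apply: f0; rewrite mem_cat yt.
Qed.

End Finiteness.

(** * Simple constituents of restrictions *)

Section CliffordTheory.
Variables (k : fieldType) (A B : hopfAlgType k) (pi : hopfMor A B).
Hypothesis pi_surj : forall y : B, exists x : A, pi x = y.
Hypothesis ssA : cosemisimple A.
Hypothesis ssB : cosemisimple B.

(** Semisimplicity of the restriction identifies quotients with summands. *)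
Lemma constituents_sim (V : irrep A) (W : irrep B) :
  constituents (Res pi V) W <-> sim pi V W.
Proof. exact: simple_summandP (@ssB _) (simpleP W). Qed.

(** The restriction is nonzero and semisimple, so it contains a simple
    subcomodule, which splits off. *)
Lemma sim_exr (V : irrep A) : exists W : irrep B, sim pi V W.
Proof.
have [v v0] := simple_neq0 (simpleP V).
have ssV := @ssB (Res pi V).
have [S [hS [sS [x x0]]]] := @semisimple_hom_neq0 _ _ (Res pi V) _ (comod_id _) v ssV v0.
have simS := subcomodule_simple hS sS.
have [|r rK] := simple_sub_splits ssV simS (i := subcomod_incl hS); first by exists x.
exists (irrep_of (SimpleComod simS)).
apply: hom_neq0_iso (comod_iso_refl _) (irrep_ofK _) _.
have [y y0] := simple_neq0 simS.
by exists r, (subcomod_incl hS y); rewrite rK.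
Qed.

Lemma pi_regular_subproof x :
  coact (regular B) ((pi : {linear A -> B}) x) =
  tmap pi idfun (coact (Res pi (regular A)) x).
Proof.
rewrite -[LHS]/(comul (pi x)) hopf_mor_comul.
by rewrite -[coact (Res _ _) _]/(tmap _ _ (comul x)) tmap_comp; apply: eq_tmap.
Qed.

Definition pi_regular : comodHom (Res pi (regular A)) (regular B) :=
  @ComodHom _ _ (Res pi (regular A)) (regular B) (pi : {linear A -> B})
    pi_regular_subproof.

Lemma res_hom_subproof (V V' : comod A) (f : comodHom V V') v :
  coact (Res pi V') ((f : {linear V -> V'}) v) =
  tmap f idfun (coact (Res pi V) v).
Proof.
rewrite -[LHS]/(tmap idfun pi (coact V' (f v))) comod_homP.
exact: tmapC.
Qed.

Definition res_hom (V V' : comod A) (f : comodHom V V') :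
    comodHom (Res pi V) (Res pi V') :=
  @ComodHom _ _ (Res pi V) (Res pi V') (f : {linear V -> V'})
    (res_hom_subproof f).

(** The simple W is a quotient of the regular comodule of B, hence of the
    restriction of the regular comodule of A, as pi is surjective. The latter
    is a sum of simple comodules over A, and one of them is not killed. *)
Lemma sim_exl (W : irrep B) : exists V : irrep A, sim pi V W.
Proof.
have [w w0] := simple_neq0 (simpleP W).
have [psi psiw] := functional_neq0 w0.
have cw : coef psi w != 0.
  by apply: contraNneq psiw; rewrite -counit_coef => ->; rewrite linear0.
have [|r rK] := @simple_sub_splits _ _ (regular B) W (coef_hom psi) (@ssB _) (simpleP W).
  by exists w.
have [x xw] := pi_surj (coef psi w).
have rx : r (pi x) = w by rewrite xw; apply: rK.
have [s [xE sS]] := @ssA (regular A) x.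
pose g : comodHom (Res pi (regular A)) W := comod_comp r pi_regular.
have [y [ys gy]] : exists y, y \in s /\ g y != 0.
  apply: contrapT => ny; move/eqP: w0; apply; rewrite -rx.
  rewrite -[LHS]/(g x) xE [LHS]linear_sum big_seq big1 // => y ys.
  by apply: contrapT => /eqP gy; apply: ny; exists y.
have [S [sS' Sy]] := sS _ ys; have [hS _ _] := sS'.
have simS := subcomodule_simple hS sS'.
have [z zy] := subcomod_incl_surj hS Sy.
pose h := comod_comp g (res_hom (subcomod_incl hS)).
have [i [j [iK jK]]] := irrep_ofK (SimpleComod simS).
exists (irrep_of (SimpleComod simS)).
exists (comod_comp h (res_hom j)), (i z).
by rewrite -[X in X != 0]/(g (subcomod_incl hS (j (i z)))) iK zy.
Qed.

(** The restriction of V is spanned by the finitely many left factors of one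
    coaction, so it is a finite sum of simple subcomodules, and every simple
    quotient is isomorphic to one of these. *)
Lemma slice_r_finite (V : irrep A) : finite_pred (slice_r pi V).
Proof.
have [v v0] := simple_neq0 (simpleP V).
have span := simple_comod_span (simpleP V) v0.
pose l : seq (Res pi V) := [seq p.1 | p <- (repr (coact V v) : seq (V * A))].
have [s [sS sl]] := semisimple_span l (@ssB _).
have ex (i : 'I_(size s)) : exists T : irrep B,
    forall (W : irrep B) (f : comodHom (Res pi V) W),
      f (tnth (in_tuple s) i) != 0 -> W = T.
  have [S [simS Sx]] := sS _ (mem_tnth i (in_tuple s)).
  exact: simple_element_irrep simS Sx.
exists (size s), (fun i => sval (cid (ex i))) => W [f [u fu]].
have [i fi] : exists i, f (tnth (in_tuple s) i) != 0.
  apply: contrapT => nf; move/eqP: fu; apply.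
  have f0 : forall x, x \in s -> f x = 0.
    move=> x /(tnthP (in_tuple s))[i ->].
    by apply: contrapT => /eqP fi; apply: nf; exists i.
  have [eta ->] := span u.
  rewrite (tensorE (coact V v)) linear_sum [LHS]linear_sum big_seq big1 // => p ps.
  have fp : f p.1 = 0 by apply: sl f0 _ _; apply/mapP; exists p.
  by rewrite rsliceE [LHS]linearZ fp; exact: scaler0.
by exists i; apply: (svalP (cid (ex i))) fi.
Qed.

Hypothesis pi_normal : normal_embedding pi.

Lemma quotient_coef (M W : comod B) (q : {linear B -> B}) (f : comodHom M W) :
  simple_comod W -> (exists m, f m != 0) ->
  (forall m, tmap idfun q (coact M m) = 0) ->
  forall w, tmap idfun q (coact W w) = 0.
Proof.
move=> sW f0 qM w; have [m <-] := simple_hom_surj sW f0 w.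
by rewrite comod_homP tmapC qM linear0.
Qed.

(** Let E be the space of coefficients of V' over B. The vectors of V with
    coefficients in E form a subcomodule by [isotypic_subcomod]; it contains a
    copy of W, so it is all of V by simplicity. Hence the coefficients of W'
    lie in E, and [coef_space_hom] applies. *)
Lemma constituents_shared (V V' : comod A) (W W' : comod B) :
  simple_comod V -> simple_comod W -> simple_comod W' ->
  hom_neq0 (Res pi V) W -> hom_neq0 (Res pi V') W ->
  hom_neq0 (Res pi V) W' -> hom_neq0 (Res pi V') W'.
Proof.
move=> sV sW sW' [f [v fv]] [g [v' gv']] [h [u hu]].
have [q qE] := subspace_ker (coef_space_subspace (Res pi V')).
have qW w : tmap idfun q (coact W w) = 0.
  apply: (quotient_coef sW (f := g)); [by exists v'|exact: coact_coef_space].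
have [|i iK] := simple_quotient_splits (@ssB _) sW (f := f); first by exists v.
have [w w0] := simple_neq0 sW.
pose X : set V := [set v | tmap idfun (q \o pi) (coact V v) = 0].
have qX m : X m <-> tmap idfun q (coact (Res pi V) m) = 0.
  by rewrite /X /= tmap_compr.
have cX : subcomod X by apply: isotypic_subcomod qE.
have Xiw : X (i w) by apply/qX; rewrite comod_homP tmapC qW linear0.
have [XE|XE] := simple_subcomod_cases sV cX.
  by move: Xiw w0; rewrite XE -{2}(iK w) => /= ->; rewrite linear0 eqxx.
apply: (coef_space_hom ssB sW' qE).
apply: (quotient_coef sW' (f := h)); first by exists u.
by move=> m; apply/qX; rewrite XE.
Qed.

Lemma sim_shared (V V' : irrep A) (W W' : irrep B) :
  sim pi V W -> sim pi V' W -> sim pi V W' -> sim pi V' W'.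
Proof. exact: constituents_shared (simpleP V) (simpleP W) (simpleP W'). Qed.

End CliffordTheory.

Theorem theorem0p2 (k : closedFieldType) (OG OH : hopfAlgType k)
    (pi : hopfMor OG OH)
    (pi_surj : forall y : OH, exists x : OG, pi x = y)
    (pi_normal : normal_embedding pi)
    (OG_cosemisimple : cosemisimple OG)
    (OH_cosemisimple : cosemisimple OH) :
  (forall (V : irrep OG) (W : irrep OH), sim pi V W <-> hom_neq0 V (Ind pi W)) /\
  (is_equivalence (simG pi) /\ are_classes (slice_l pi) (simG pi)) /\
  ((exists R : irrep OH -> irrep OH -> Prop,
      is_equivalence R /\ are_classes (slice_r pi) R) /\
   (forall V : irrep OG, finite_pred (slice_r pi V))).
Proof.
have shared := sim_shared OH_cosemisimple pi_normal.
have simPi := constituents_sim pi OH_cosemisimple.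
have simGP V V' W : sim pi V W -> simG pi V V' <-> sim pi V' W.
  move=> VW; split=> [e|V'W W']; first exact/simPi/e/simPi.
  split=> /simPi VW'; apply/simPi; first exact: shared VW V'W VW'.
  exact: shared V'W VW VW'.
split; first by move=> V W; split; [exact: frobenius_fwd|exact: frobenius_bwd].
split; [split|split; last exact: slice_r_finite].
- split=> [V W //|V V' e W|V V' V'' e e' W]; first by rewrite e.
  by rewrite e e'.
- split=> [W|V].
    have [V VW] := sim_exl pi_surj OG_cosemisimple OH_cosemisimple W.
    by exists V => V'; symmetry; apply: simGP.
  have [W VW] := sim_exr pi OH_cosemisimple V.
  by exists W => V'; symmetry; apply: simGP.
exists (fun W W' => exists V, sim pi V W /\ sim pi V W'); split.
  split=> [W|W W' [V [VW VW']]|W W' W'' [V [VW VW']] [V' [V'W' V'W'']]].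
  - have [V VW] := sim_exl pi_surj OG_cosemisimple OH_cosemisimple W.
    by exists V.
  - by exists V.
  by exists V; split=> //; apply: shared V'W' VW' V'W''.
split=> [V|W].
  have [W VW] := sim_exr pi OH_cosemisimple V.
  exists W => W'; split=> [VW'|[V' [V'W V'W']]]; first by exists V.
  exact: shared V'W VW V'W'.
have [V VW] := sim_exl pi_surj OG_cosemisimple OH_cosemisimple W.
exists V => W'; split=> [VW'|[V' [V'W V'W']]]; first by exists V.
exact: shared V'W VW V'W'.
Qed.
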